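(* Let $A:\mathbb{R}^n\rightrightarrows\mathbb{R}^n$ be a maximal monotone operator and let $F:\mathbb{R}^n\rightrightarrows\mathbb{R}^n$ be an $L$-Lipschitz Cusco mapping. Let $V,W:\mathbb{R}^n\to\mathbb{R}\cup\{+\infty\}$ be two proper lower semicontinuous functions such that $\mathrm{dom}\,V\subset\mathrm{dom}\,A$ and $W\ge0$, and let $a\ge0$. Let $\partial$ stand for either $\partial_P$ or $\partial_F$. Then the pair $(V,W)$ is a strong $a$-Lyapunov pair for the differential inclusion $\dot x(t)\in F(x(t))-A(x(t))$ a.e. $t\ge 0$, $x(0)=x_0\in\overline{\mathrm{dom}\,A}$, if and only if for all $x\in\mathrm{dom}\,V$ $$\sup_{\xi\in\partial V(x)}\ \sup_{v\in F(x)}\ \inf_{x^*\in A(x)}\langle\xi,v-x^*\rangle+aV(x)+W(x)\le0$$ and $$\sup_{\xi\in\partial_{P,\infty}V(x)}\ \sup_{v\in F(x)}\ \inf_{x^*\in A(x)}\langle\xi,v-x^*\rangle\le0.$$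
   Context: $\mathbb{R}^n$ carries its Euclidean inner product and norm. $\mathrm{dom}\,A=\{x: A(x)\ne\emptyset\}$ and $\mathrm{dom}\,V=\{x:V(x)<+\infty\}$. $F$ is an $L$-Lipschitz Cusco mapping if it has nonempty, convex, compact values and $F(x)\subset F(y)+L\|x-y\|\,\mathrm{B}_1$ for all $x,y$, where $\mathrm{B}_1$ is the closed unit ball. A solution of the differential inclusion is a continuous function $x:[0,\infty)\to\mathbb{R}^n$ that is absolutely continuous on every compact subset of $(0,+\infty)$, with $x(0)=x_0$ and $\dot x(t)\in F(x(t))-A(x(t))$ for a.e. $t\ge0$. $(V,W)$ is a strong $a$-Lyapunov pair if for every $x_0\in\overline{\mathrm{dom}\,A}$ and every solution $x(\cdot;x_0)$ starting at $x_0$, $$e^{at}V(x(t;x_0))+\int_0^tW(x(\tau;x_0))\,d\tau\le V(x_0)\quad\forall t\ge0.$$ For $x\in\mathrm{dom}\,V$: $\xi\in\partial_PV(x)$ (proximal subdifferential) iff $\liminf_{y\to x,y\ne x}\frac{V(y)-V(x)-\langle\xi,y-x\rangle}{\|y-x\|^2}>-\infty$; $\xi\in\partial_FV(x)$ (Fréchet subdifferential) iff $\liminf_{y\to x,y\neq x}\frac{V(y)-V(x)-\langle\xi,y-x\rangle}{\|y-x\|}\ge0$; $\xi\in\partial_{P,\infty}V(x)$ (singular prox-subdifferential) iff $(\xi,0)\in\mathrm{N}^P_{\mathrm{epi}V}(x,V(x))$, where $\mathrm{epi}V=\{(x,\alpha)\in\mathbb{R}^{n+1}:V(x)\le\alpha\}$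 and, for a closed set $C$ and $c\in C$, $\mathrm{N}^P_C(c)$ is the proximal subdifferential at $c$ of the indicator function of $C$. Conventions: the supremum over the empty set is $-\infty$, and an inequality $p+aV(x)+W(x)\le0$ is read as $p\le -aV(x)-W(x)$ in the extended reals. *)

(* Defs.v *)
From HB Require Import structures.
From mathcomp Require Import all_boot all_order all_algebra.
From mathcomp Require Import all_classical all_reals all_analysis.
Set Implicit Arguments. Unset Strict Implicit. Unset Printing Implicit Defensive.
Import Order.TTheory GRing.Theory Num.Theory numFieldNormedType.Exports.
Local Open Scope classical_set_scope.
Local Open Scope ring_scope.

(* R^n is 'rV[R]_n. The library's norm on it is the sup norm, hence the explicit
   inner product and Euclidean norm; the library topology (closure, compactness,
   neighbourhoods, limits, derivatives) is the Euclidean one. *)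
Definition dot (R : realType) (n : nat) (u v : 'rV[R]_n) : R :=
  \sum_(i < n) u 0 i * v 0 i.

Definition enorm (R : realType) (n : nat) (u : 'rV[R]_n) : R :=
  Num.sqrt (dot u u).

Definition setval_dom (R : realType) (n : nat) (A : 'rV[R]_n -> set 'rV[R]_n) :
    set 'rV[R]_n :=
  [set x | A x !=set0].

Definition monotone_op (R : realType) (n : nat)
    (A : 'rV[R]_n -> set 'rV[R]_n) : Prop :=
  forall x y xs ys, A x xs -> A y ys -> 0 <= dot (xs - ys) (x - y).

Definition maximal_monotone (R : realType) (n : nat)
    (A : 'rV[R]_n -> set 'rV[R]_n) : Prop :=
  monotone_op A /\
  forall B : 'rV[R]_n -> set 'rV[R]_n, monotone_op B ->
    (forall x, A x `<=` B x) -> B = A.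

Definition lipschitz_cusco (R : realType) (n : nat) (L : R)
    (F : 'rV[R]_n -> set 'rV[R]_n) : Prop :=
  (forall x, [/\ F x !=set0, convex_set (F x) & compact (F x)]) /\
  (forall x y, F x `<=`
     [set w + (L * enorm (x - y)) *: b | w in F y & b in [set b | enorm b <= 1]]).

Definition edom (R : realType) (n : nat) (V : 'rV[R]_n -> \bar R) : set 'rV[R]_n :=
  [set x | (V x < +oo)%E].

(* The first conjunct encodes the codomain R \cup {+oo}. *)
Definition proper_fun (R : realType) (n : nat) (V : 'rV[R]_n -> \bar R) : Prop :=
  (forall x, (-oo < V x)%E) /\ edom V !=set0.

(* Absolute continuity of x restricted to K: the intervals are nonoverlapping
   and have their endpoints in K. *)
Definition abs_continuous_on (R : realType) (n : nat) (K : set R)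
    (x : R -> 'rV[R]_n) : Prop :=
  forall eps : R, 0 < eps -> exists2 delta : R, 0 < delta &
    forall (m : nat) (s t : 'I_m -> R),
      (forall i, [/\ K (s i), K (t i) & s i <= t i]) ->
      trivIset setT (fun i => `]s i, t i[%classic) ->
      \sum_(i < m) (t i - s i) < delta ->
      \sum_(i < m) enorm (x (t i) - x (s i)) < eps.

(* A function on [0, +oo[ is a function on R of which only the restriction to
   [0, +oo[ matters: the derivative at 0 concerns a null set. *)
Definition is_solution (R : realType) (n : nat)
    (A F : 'rV[R]_n -> set 'rV[R]_n) (x0 : 'rV[R]_n) (x : R -> 'rV[R]_n) : Prop :=
  [/\ {within `[0, +oo[%classic, continuous x},
      forall K : set R, compact K -> K `<=` `]0, +oo[%classic ->
        abs_continuous_on K x,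
      x 0 = x0 &
      \forall t \ae (@lebesgue_measure R), 0 <= (t : R) ->
        derivable x t 1 /\
        [set v - xs | v in F (x t) & xs in A (x t)] ('D_1 x t)].

Definition strong_lyapunov_pair (R : realType) (n : nat)
    (A F : 'rV[R]_n -> set 'rV[R]_n) (V W : 'rV[R]_n -> \bar R) (a : R) : Prop :=
  forall x0, closure (setval_dom A) x0 ->
  forall x : R -> 'rV[R]_n, is_solution A F x0 x ->
  forall t : R, 0 <= t ->
    ((expR (a * t))%:E * V (x t)
      + \int[@lebesgue_measure R]_(tau in `[0%R, t]) W (x tau) <= V x0)%E.

Definition prox_subdiff (R : realType) (n : nat) (V : 'rV[R]_n -> \bar R)
    (x : 'rV[R]_n) : set 'rV[R]_n :=
  [set xi | edom V x /\
    (-oo < limf_einf (fun y : 'rV[R]_n =>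
       (V y - V x - (dot xi (y - x)%R)%:E) * ((enorm (y - x) ^+ 2)^-1)%:E)
       (x^')%classic)%E].

Definition frechet_subdiff (R : realType) (n : nat) (V : 'rV[R]_n -> \bar R)
    (x : 'rV[R]_n) : set 'rV[R]_n :=
  [set xi | edom V x /\
    (0 <= limf_einf (fun y : 'rV[R]_n =>
       (V y - V x - (dot xi (y - x)%R)%:E) * ((enorm (y - x))^-1)%:E)
       (x^')%classic)%E].

Definition set_indicator (R : realType) (n : nat) (C : set 'rV[R]_n)
    (z : 'rV[R]_n) : \bar R :=
  if z \in C then 0%E else +oo%E.

Definition prox_normal (R : realType) (n : nat) (C : set 'rV[R]_n)
    (c : 'rV[R]_n) : set 'rV[R]_n :=
  prox_subdiff (set_indicator C) c.

(* (x, alpha) in R^(n+1) is the row vector row_mx x alpha%:M. *)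
Definition epigraph (R : realType) (n : nat) (V : 'rV[R]_n -> \bar R) :
    set 'rV[R]_(n + 1) :=
  [set z | (V (lsubmx z) <= (rsubmx z 0 0)%:E)%E].

Definition singular_prox_subdiff (R : realType) (n : nat)
    (V : 'rV[R]_n -> \bar R) (x : 'rV[R]_n) : set 'rV[R]_n :=
  [set xi | edom V x /\
    prox_normal (epigraph V) (row_mx x (fine (V x))%:M) (row_mx xi 0)].

Definition sup_sup_inf (R : realType) (n : nat) (D Fx Ax : set 'rV[R]_n) : \bar R :=
  ereal_sup [set ereal_sup [set ereal_inf [set (dot xi (v - xs))%:E
    | xs in Ax] | v in Fx] | xi in D].

(* Main.v *)
Require Import Defs.
From HB Require Import structures.
From mathcomp Require Import all_boot all_order all_algebra.
From mathcomp Require Import all_classical all_reals all_analysis.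
From mathcomp Require Import measurable_realfun ring lra.
Import Order.TTheory GRing.Theory Num.Theory numFieldNormedType.Exports.
Local Open Scope classical_set_scope.
Local Open Scope ring_scope.
Set Implicit Arguments. Unset Strict Implicit. Unset Printing Implicit Defensive.

(** The infinitesimal conditions and the Lyapunov inequality are two readings of
    the same fact: trajectories started on the epigraph of [V] and pushed down
    by [a V + W] stay in the epigraph.

    From the Lyapunov inequality to the conditions one needs, for every
    [v \in F x0], a solution whose right velocities at [0] belong to [v - A x0].
    It is built by an implicit Euler scheme: the resolvents of [A] are total by
    Minty's theorem ([resolvent_total]), and each element of [F] is chosen close
    to the previous one, so that by monotonicity of [A] the discrete velocities
    stay bounded ([euler_velocity_le]). Limits along an ultrafilter give a
    locally Lipschitz curve ([euler_limit]). It is differentiable almost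
    everywhere ([lipschitz_derivable_ae], by Radon-Nikodym and Lebesgue
    differentiation), and an energy inequality together with maximality of [A]
    shows that right difference quotients accumulate only at points of
    [f - A x] ([energy_quotient]). Dividing the Lyapunov inequality by the time
    gives both conditions, even for Frechet subgradients
    ([lyapunov_velocity]).

    Conversely, let [x] be any solution and let [z] solve
    [z' = - a z - e^(- a t) w x] from [z 0 = V (x 0)], where [w <= W] is
    Lipschitz and bounded. If [(y, b)] is a projection of [(x, z)] on the
    epigraph of [V], then [x - y] is, up to scaling, a proximal or a singular
    proximal subgradient at [y] ([epi_nearest_prox], [epi_nearest_singular]).
    Monotonicity of [A] gives [<x - y, - xs> <= <x - y, - ys>] for all
    [xs \in A x] and [ys \in A y]: the velocity at [x] is compared with the
    infimum over [A y], and only the Lipschitz errors of [F] and [w] remain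
    ([epi_dissipation]). The squared distance to the epigraph thus satisfies
    [eta' <= C eta] almost everywhere. It is absolutely continuous away from
    [0] and continuous at [0], hence it vanishes ([ac_dini_nonincreasing],
    [epigraph_invariant]). Letting [w] increase to [W] concludes
    ([infinitesimal_lyapunov]). *)

(** * Euclidean geometry of row vectors *)

Section Euclid.
Variables (R : realType) (n : nat).
Implicit Types u v w : 'rV[R]_n.

Lemma dotC u v : dot u v = dot v u.
Proof. by apply: eq_bigr => i _; rewrite mulrC. Qed.

Lemma dotDl u v w : dot (u + v) w = dot u w + dot v w.
Proof. by rewrite /dot -big_split; apply: eq_bigr => i _; rewrite mxE mulrDl. Qed.

Lemma dotDr u v w : dot w (u + v) = dot w u + dot w v.
Proof. by rewrite dotC dotDl !(dotC _ w). Qed.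

Lemma dotZl k u v : dot (k *: u) v = k * dot u v.
Proof. by rewrite /dot mulr_sumr; apply: eq_bigr => i _; rewrite mxE mulrA. Qed.

Lemma dotZr k u v : dot u (k *: v) = k * dot u v.
Proof. by rewrite dotC dotZl dotC. Qed.

Lemma dotNl u v : dot (- u) v = - dot u v.
Proof. by rewrite -scaleN1r dotZl mulN1r. Qed.

Lemma dotNr u v : dot u (- v) = - dot u v.
Proof. by rewrite dotC dotNl dotC. Qed.

Lemma dotBl u v w : dot (u - v) w = dot u w - dot v w.
Proof. by rewrite dotDl dotNl. Qed.

Lemma dotBr u v w : dot w (u - v) = dot w u - dot w v.
Proof. by rewrite dotDr dotNr. Qed.

Lemma dot0l u : dot 0 u = 0.
Proof. by rewrite -(scale0r u) dotZl mul0r. Qed.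

Lemma dot0r u : dot u 0 = 0.
Proof. by rewrite dotC dot0l. Qed.

Lemma dot_suml I (r : seq I) (P : pred I) (f : I -> 'rV[R]_n) v :
  dot (\sum_(i <- r | P i) f i) v = \sum_(i <- r | P i) dot (f i) v.
Proof.
by elim/big_ind2: _ => [|? ? ? ? <- <-|//]; rewrite ?dot0l ?dotDl.
Qed.

Lemma dot_ge0 u : 0 <= dot u u.
Proof. by apply: sumr_ge0 => i _; rewrite -expr2 sqr_ge0. Qed.

Lemma enorm_ge0 u : 0 <= enorm u.
Proof. exact: sqrtr_ge0. Qed.

Lemma sqr_enorm u : enorm u ^+ 2 = dot u u.
Proof. by rewrite sqr_sqrtr // dot_ge0. Qed.

Lemma sqr_enormD u v :
  enorm (u + v) ^+ 2 = enorm u ^+ 2 + 2 * dot u v + enorm v ^+ 2.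
Proof. by rewrite !sqr_enorm dotDl !dotDr (dotC v u); ring. Qed.

Lemma enorm0 : enorm (0 : 'rV[R]_n) = 0.
Proof. by rewrite /enorm dot0l sqrtr0. Qed.

Lemma enormZ k u : enorm (k *: u) = `|k| * enorm u.
Proof.
by rewrite /enorm dotZl dotZr mulrA -expr2 sqrtrM ?sqr_ge0 // sqrtr_sqr.
Qed.

Lemma enormN u : enorm (- u) = enorm u.
Proof. by rewrite -scaleN1r enormZ normrN1 mul1r. Qed.

Lemma enormB u v : enorm (u - v) = enorm (v - u).
Proof. by rewrite -enormN opprB. Qed.

(** Cauchy-Schwarz: the squared length of [<v, v> u - <u, v> v] is [<v, v>]
    times [<u, u> <v, v> - <u, v>^2]. *)
Lemma dot_le u v : dot u v <= enorm u * enorm v.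
Proof.
have [/eqP v0|v0] := eqVneq (enorm v) 0.
  have vv : dot v v = 0 by rewrite -sqr_enorm (eqP v0) expr0n.
  have hv (i : 'I_n) : v 0 i = 0.
    have /eqP := vv; rewrite psumr_eq0 => [|j _]; last by rewrite -expr2 sqr_ge0.
    by move=> /allP /(_ i (mem_index_enum _)); rewrite /= mulf_eq0 orbb => /eqP.
  rewrite (eqP v0) mulr0 /dot big1 // => i _; by rewrite hv mulr0.
have vp : 0 < enorm v by rewrite lt_def v0 enorm_ge0.
apply: ler_normlW; rewrite -(@ler_pXn2r _ 2) ?nnegrE ?mulr_ge0 ?enorm_ge0 //.
rewrite real_normK ?num_real // exprMn !sqr_enorm.
have := dot_ge0 (dot v v *: u - dot u v *: v).
rewrite !(dotBl, dotBr, dotZl, dotZr) (dotC v u).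
set d := (X in 0 <= X -> _).
have -> : d = dot v v * (dot u u * dot v v - dot u v ^+ 2) by rewrite /d; ring.
by rewrite pmulr_rge0 ?subr_ge0 // -sqr_enorm exprn_gt0.
Qed.

Lemma normr_dot_le u v : `|dot u v| <= enorm u * enorm v.
Proof.
by rewrite ler_norml dot_le andbT lerNl -dotNl (le_trans (dot_le _ _)) ?enormN.
Qed.

Lemma enormD u v : enorm (u + v) <= enorm u + enorm v.
Proof.
rewrite -(@ler_pXn2r _ 2) ?nnegrE ?addr_ge0 ?enorm_ge0 //.
rewrite sqr_enormD sqrrD; have := dot_le u v; lra.
Qed.

Lemma enorm_triangle v u w : enorm (u - w) <= enorm (u - v) + enorm (v - w).
Proof. by rewrite (le_trans _ (enormD _ _)) // addrA subrK. Qed.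

Lemma ler_enormB u v : enorm u - enorm v <= enorm (u - v).
Proof. by rewrite lerBlDr (le_trans _ (enormD _ _)) // subrK. Qed.

Lemma coord_le_enorm u i : `|u 0 i| <= enorm u.
Proof.
rewrite -sqrtr_sqr ler_wsqrtr // /dot (bigD1 i) //= -expr2 lerDl.
by apply: sumr_ge0 => j _; rewrite -expr2 sqr_ge0.
Qed.

(** The topology of row vectors is that of the sup norm; the two comparisons
    with the Euclidean norm let limits be expressed by [enorm]. *)
Lemma norm_le_enorm u : `|u| <= enorm u.
Proof.
rewrite [`|u|]mx_normrE; apply/bigmax_leP; split; first exact: enorm_ge0.
by move=> [i j] _ /=; rewrite ord1 coord_le_enorm.
Qed.

Lemma coord_le_norm u i : `|u 0 i| <= `|u|.
Proof.
by rewrite [leRHS]mx_normrE; apply/bigmax_geP; right; exists (0, i).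
Qed.

Lemma enorm_le_norm u : enorm u <= n%:R * `|u|.
Proof.
rewrite -(@ler_pXn2r _ 2) ?nnegrE ?mulr_ge0 ?enorm_ge0 // sqr_enorm.
apply: (@le_trans _ _ (\sum_(i < n) `|u| ^+ 2)).
  apply: ler_sum => i _; rewrite -expr2 -real_normK ?num_real //.
  by rewrite ler_pXn2r ?nnegrE // coord_le_norm.
rewrite sumr_const card_ord -(mulr_natl (_ ^+ _)) exprMn ler_wpM2r ?sqr_ge0 //.
by rewrite -natrX ler_nat; case: (n) => // k; rewrite leq_pmulr.
Qed.

Lemma enorm_eq0 u : enorm u = 0 -> u = 0.
Proof.
by move=> u0; apply/eqP; rewrite -normr_le0 -u0 norm_le_enorm.
Qed.

Lemma enorm_gt0 u : u != 0 -> 0 < enorm u.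
Proof. by move=> u0; rewrite lt_def enorm_ge0 andbT; apply: contraNneq u0 => /enorm_eq0 ->. Qed.

Lemma cvg_enormP {T : Type} {F : set_system T} {FF : Filter F} (f : T -> 'rV[R]_n) (l : 'rV[R]_n) :
  (f @ F --> l) <-> (forall e, 0 < e -> \forall t \near F, enorm (f t - l) < e).
Proof.
split=> [/cvgrPdist_lt fl e e0|fl].
  have n1 : 0 < (n%:R + 1 : R) by rewrite ltr_wpDl.
  have e1 : 0 < e / (n%:R + 1) by rewrite divr_gt0.
  apply: filterS (fl _ e1) => t; rewrite ltr_pdivlMr // mulrC distrC => ft.
  apply: le_lt_trans (enorm_le_norm _) (le_lt_trans _ ft).
  by rewrite ler_wpM2r // lerDl.
apply/cvgrPdist_lt => e /fl; apply: filterS => t.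
by rewrite distrC; apply: le_lt_trans (norm_le_enorm _).
Qed.

Lemma cvg_dot {T : Type} {F : set_system T} {FF : Filter F}
    (f g : T -> 'rV[R]_n) (l m : 'rV[R]_n) :
  f @ F --> l -> g @ F --> m -> dot (f t) (g t) @[t --> F] --> dot l m.
Proof.
move=> fl gm; apply: cvg_big => [|i _]; first by move=> x; exact: add_continuous.
have coord (h : T -> 'rV[R]_n) (k : 'rV[R]_n) :
    h @ F --> k -> h t 0 i @[t --> F] --> k 0 i.
  move=> hk; apply: (@cvg_comp _ _ _ h (fun u : 'rV[R]_n => u 0 i) _ _ _ hk).
  exact: (@coord_continuous R 1 n 0 i).
by apply: cvgM; exact: coord.
Qed.

Lemma cvg_enorm {T : Type} {F : set_system T} {FF : Filter F}
    (f : T -> 'rV[R]_n) (l : 'rV[R]_n) :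
  f @ F --> l -> enorm (f t) @[t --> F] --> enorm l.
Proof.
move=> fl; apply: (@cvg_comp _ _ _ (fun t => dot (f t) (f t)) (@Num.sqrt R)).
  exact: (cvg_dot fl fl).
exact: sqrt_continuous.
Qed.

Lemma closed_enorm_le u (r : R) : closed [set v | enorm (v - u) <= r].
Proof.
apply: (@preimage_closed _ _ (fun v => enorm (v - u)) [set s | s <= r]).
  move=> v _; apply: (@cvg_enorm _ (nbhs v) _ (fun v => v - u)).
  by apply: cvgB; [exact: cvg_id|exact: cvg_cst].
exact: closed_le.
Qed.

Lemma compact_enorm_le u (r : R) : compact [set v | enorm (v - u) <= r].
Proof.
apply: bounded_closed_compact; last exact: closed_enorm_le.
exists (enorm u + r); split; first exact: num_real.
move=> M hM v /= vr; apply: le_trans (norm_le_enorm v) (le_trans _ (ltW hM)).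
by have := ler_enormB v u; lra.
Qed.

Lemma nearest_point (C : set 'rV[R]_n) p : closed C -> C !=set0 ->
  exists2 c, C c & forall d, C d -> enorm (p - c) <= enorm (p - d).
Proof.
move=> cC [c0 Cc0]; pose K := C `&` [set v | enorm (v - p) <= enorm (c0 - p)].
have cK : compact K.
  rewrite /K setIC; apply: compact_closedI => //; exact: compact_enorm_le.
have K0 : K !=set0 by exists c0; split => /=.
have [|c] := @EVT_min_rV _ _ (fun v => enorm (p - v)) K K0 cK.
- apply: continuous_subspaceT => v.
  apply: (@cvg_enorm _ (nbhs v) _ (fun v => p - v)).
  by apply: cvgB; [exact: cvg_cst|exact: cvg_id].
- rewrite inE => -[Cc /= cp] cmin; exists c => // d Cd.
  have [dp|/ltW dp] := leP (enorm (d - p)) (enorm (c0 - p)).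
    by apply: cmin; rewrite inE.
  by rewrite (enormB p c) (enormB p d) (le_trans cp).
Qed.

End Euclid.

(** * Resolvents of maximal monotone operators *)

Section Minty.
Variables (R : realType) (n : nat).

Lemma compact_simplex m :
  compact [set mu : 'rV[R]_m | (forall i, 0 <= mu 0 i) /\ \sum_i mu 0 i = 1].
Proof.
have coord (i : 'I_m) : continuous (fun mu : 'rV[R]_m => mu 0 i).
  exact: (@coord_continuous R 1 m 0 i).
apply: bounded_closed_compact.
  exists 1; split; first exact: num_real.
  move=> M M1 mu [mu0 mu1]; apply: le_trans (ltW M1).
  rewrite [`|_|]mx_normrE; apply/bigmax_leP; split => // -[i j] _ /=.
  rewrite ord1 ger0_norm // -mu1 (bigD1 j) //= lerDl.
  by apply: sumr_ge0 => k _.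
rewrite (_ : [set _ | _] = (\bigcap_(i in @setT 'I_m) [set mu : 'rV[R]_m | 0 <= mu 0 i])
  `&` [set mu | \sum_i mu 0 i = 1]); last first.
  apply/seteqP; split=> mu [h1 h2]; split => // i; first by move=> _; exact: h1.
  exact: h1.
apply: closedI.
  apply: closed_bigI => i _.
  apply: (@preimage_closed _ _ (fun mu : 'rV[R]_m => mu 0 i) [set s | 0 <= s]).
    by move=> mu _; exact: coord.
  exact: closed_ge.
apply: (@preimage_closed _ _ (fun mu : 'rV[R]_m => \sum_i mu 0 i) [set s | s = 1]).
  move=> mu _; apply: (@cvg_big _ _ _ _ _ _ _ (nbhs mu)).
    by move=> x; exact: add_continuous.
  by move=> i _; exact: coord.
exact: closed_eq.
Qed.

(** The functions [g_i x = <x - p + b_i, x - a_i>] all have quadratic part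
    [|x|^2], so the minimum [G] over [x] of a convex combination of them is
    explicit. At a maximiser of [G] over the simplex the first-order condition
    says [g_i x <= G] for the minimiser [x], and monotonicity bounds [G] by [0]:
    evaluate the combination at the barycentre of the [a_i]. *)
Lemma monotone_finite_resolvent m (a b : 'I_m -> 'rV[R]_n) p :
  (forall i j, 0 <= dot (b i - b j) (a i - a j)) ->
  exists x, forall i, dot (x - p + b i) (x - a i) <= 0.
Proof.
case: m a b => [|m] a b mon; first by exists 0; case.
pose S := [set mu : 'rV[R]_m.+1 | (forall i, 0 <= mu 0 i) /\ \sum_i mu 0 i = 1].
pose B (mu : 'rV[R]_m.+1) := \sum_i mu 0 i *: (p - b i + a i).
pose C (mu : 'rV[R]_m.+1) := \sum_i mu 0 i * dot (p - b i) (a i).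
pose G mu := C mu - dot (B mu) (B mu) / 4.
have coord (i : 'I_m.+1) : continuous (fun mu : 'rV[R]_m.+1 => mu 0 i).
  exact: (@coord_continuous R 1 m.+1 0 i).
have BZ s (mu nu : 'rV[R]_m.+1) : B (mu + s *: (nu - mu)) = B mu + s *: (B nu - B mu).
  rewrite /B -sumrB scaler_sumr -big_split; apply: eq_bigr => i _ /=.
  by rewrite !mxE scalerDl scalerBr !scalerA -scalerBl mulrBr scalerBl.
have CZ s (mu nu : 'rV[R]_m.+1) : C (mu + s *: (nu - mu)) = C mu + s * (C nu - C mu).
  rewrite /C -sumrB mulr_sumr -big_split; apply: eq_bigr => i _ /=.
  by rewrite !mxE; ring.
have contG : continuous G.
  move=> mu; have cB : B nu @[nu --> mu] --> B mu.
    apply: (@cvg_big _ _ _ _ _ _ _ (nbhs mu)); first by move=> x; exact: add_continuous.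
    by move=> i _; apply: cvgZ; [exact: coord|exact: cvg_cst].
  apply: (@cvgB _ _ _ (nbhs mu)); last first.
    by apply: (@cvgM _ _ (nbhs mu)); [exact: (@cvg_dot _ _ _ (nbhs mu) _ B B)|exact: cvg_cst].
  apply: (@cvg_big _ _ _ _ _ _ _ (nbhs mu)); first by move=> x; exact: add_continuous.
  by move=> i _; apply: cvgM; [exact: coord|exact: cvg_cst].
have vertex i : S (delta_mx 0 i).
  split=> [j|]; first by rewrite mxE; case: (_ && _).
  rewrite (bigD1 i) //= big1 => [|j ji]; first by rewrite mxE !eqxx addr0.
  by rewrite mxE (negPf ji) andbF.
have S0 : S !=set0 by exists (delta_mx 0 0).
have [mu] := EVT_max_rV S0 (@compact_simplex m.+1) (continuous_subspaceT contG).
rewrite inE => -[mu0 mu1] Gmax.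
(* the combination at the barycentre is a sum of the monotonicity pairings *)
have Gle0 : G mu <= 0.
  pose abar := \sum_i mu 0 i *: a i.
  apply: (@le_trans _ _ (dot abar abar - dot abar (B mu) + C mu)).
    rewrite /G; have := dot_ge0 (abar - 2^-1 *: B mu).
    rewrite !(dotBl, dotBr, dotZl, dotZr) (dotC _ abar); lra.
  have SE : dot abar abar - dot abar (B mu) + C mu =
      \sum_i mu 0 i * \sum_j mu 0 j * dot (b i) (a j - a i).
    have absum (v : 'rV[R]_n) : dot v abar = \sum_j mu 0 j * dot v (a j).
      rewrite dotC dot_suml; apply: eq_bigr => j _.
      by rewrite dotZl dotC.
    have EB : dot abar (B mu) =
        dot p abar - \sum_i mu 0 i * dot (b i) abar + dot abar abar.
      rewrite dotC dot_suml [dot abar abar]absum -[dot p abar]mul1r -mu1 mulr_suml -sumrB -big_split.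
      by apply: eq_bigr => i _; rewrite dotZl dotDl dotBl (dotC abar) /=; ring.
    have EC : C mu = dot p abar - \sum_i mu 0 i * dot (b i) (a i).
      rewrite absum -sumrB; apply: eq_bigr => i _; rewrite dotBl; ring.
    transitivity (\sum_i mu 0 i * (dot (b i) abar - dot (b i) (a i))).
      rewrite EB EC; under [RHS]eq_bigr do rewrite mulrBr.
      by rewrite sumrB; ring.
    apply: eq_bigr => i _; congr (_ * _); rewrite absum.
    rewrite -[dot (b i) (a i)]mul1r -mu1 mulr_suml -sumrB.
    by apply: eq_bigr => j _; rewrite dotBr; ring.
  rewrite SE; set s := (X in X <= 0).
  have s2 : s = \sum_i mu 0 i * \sum_j mu 0 j * dot (b j) (a i - a j).
    rewrite /s; under eq_bigr do rewrite mulr_sumr.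
    rewrite exchange_big /=; apply: eq_bigr => i _; rewrite mulr_sumr.
    by apply: eq_bigr => j _; rewrite mulrCA.
  suff : s + s <= 0 by lra.
  rewrite {2}s2 /s -big_split /= -oppr_ge0 -sumrN; apply: sumr_ge0 => i _.
  rewrite -mulrDr -mulrN -big_split /= -sumrN mulr_ge0 //; apply: sumr_ge0 => j _.
  have := mon i j; rewrite -mulrDr -mulrN => h; rewrite mulr_ge0 //.
  by move: h; rewrite !(dotBl, dotBr); lra.
exists (2^-1 *: B mu) => i; apply: le_trans Gle0.
pose e : 'rV[R]_m.+1 := delta_mx 0 i.
have Be : B e = p - b i + a i.
  rewrite /B (bigD1 i) //= big1 => [|j ji]; last by rewrite mxE (negPf ji) andbF scale0r.
  by rewrite mxE !eqxx scale1r addr0.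
have Ce : C e = dot (p - b i) (a i).
  rewrite /C (bigD1 i) //= big1 => [|j ji]; last by rewrite mxE (negPf ji) andbF mul0r.
  by rewrite mxE !eqxx mul1r addr0.
pose q := dot (B e - B mu) (B e - B mu) / 4.
have q0 : 0 <= q by rewrite divr_ge0 // dot_ge0.
pose lin := C e - C mu - dot (B mu) (B e - B mu) / 2.
have slope s : 0 < s -> s <= 1 -> lin <= s * q.
  move=> s0 s1.
  have Ss : S (mu + s *: (e - mu)).
    split=> [j|].
      have -> : (mu + s *: (e - mu)) 0 j = (1 - s) * mu 0 j + s * e 0 j.
        by rewrite !mxE; ring.
      by rewrite addr_ge0 // mulr_ge0 ?(vertex i).1 //; [lra|exact: ltW].
    transitivity (\sum_j (mu 0 j + s * (e 0 j - mu 0 j))).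
      by apply: eq_bigr => j _; rewrite !mxE.
    rewrite big_split /= -mulr_sumr sumrB mu1 (vertex i).2; ring.
  have := Gmax _ (mem_set Ss); rewrite /G BZ CZ.
  rewrite /lin /q; move: (B e - B mu) => d.
  rewrite !(dotDl, dotDr, dotZl, dotZr) (dotC d (B mu)) => h.
  rewrite -(ler_pM2l s0); move: h; lra.
have lin0 : lin <= 0.
  rewrite leNgt; apply/negP => l0.
  pose s := Num.min 1 (lin / (2 * (q + 1))).
  have s0 : 0 < s by rewrite lt_min ltr01 divr_gt0 // mulr_gt0 // ltr_wpDl.
  have s1 : s <= 1 by rewrite ge_min lexx.
  have := slope s s0 s1; apply/negP; rewrite -ltNge.
  apply: (@le_lt_trans _ _ (lin / (2 * (q + 1)) * q)).
    by rewrite ler_wpM2r // ge_min lexx orbT.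
  rewrite mulrAC ltr_pdivrMr; last by rewrite mulr_gt0 // ltr_wpDl.
  nra.
rewrite /G; move: lin0; rewrite /lin Be Ce.
rewrite -addrA !(dotBl, dotBr, dotDl, dotDr, dotZl, dotZr, dotNl, dotNr).
rewrite !(dotC _ (B mu)) !(dotC _ p); lra.
Qed.

Section Op.
Variable A : 'rV[R]_n -> set 'rV[R]_n.
Hypothesis hA : maximal_monotone A.

Lemma maximal_monotone_mem x xs :
  (forall y ys, A y ys -> 0 <= dot (xs - ys) (x - y)) -> A x xs.
Proof.
case: hA => mA maxA h.
have <- : (fun y => A y `|` [set ys | y = x /\ ys = xs]) = A; last by right.
apply: maxA => [y z ys zs|y ys Ay]; last by left.
case=> [Ay|[-> ->]] [Az|[-> ->]]; first exact: mA.
- by have := h _ _ Ay; rewrite !(dotBl, dotBr); lra.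
- exact: h.
- by rewrite subrr dot0l.
Qed.

(** Minty's theorem. The closed balls [{x | <x - p + h ys, x - y> <= 0}],
    [(y, ys)] in the graph of [A], have the finite intersection property. *)
Lemma resolvent_total (h : R) p : 0 < h -> setval_dom A !=set0 ->
  exists x xs, A x xs /\ x + h *: xs = p.
Proof.
move=> h0 [y0 [ys0 Ay0]].
pose T : choiceType := ('rV[R]_n * 'rV[R]_n)%type.
pose ball (q : T) := [set x : 'rV[R]_n | dot (x - p + h *: q.2) (x - q.1) <= 0].
have cball q : closed (ball q).
  apply: (@preimage_closed _ _
    (fun x : 'rV[R]_n => dot (x - p + h *: q.2) (x - q.1)) [set s | s <= 0]).
    move=> x _; apply: (@cvg_dot _ _ _ (nbhs x)).
      by apply: cvgD; [apply: cvgB; [exact: cvg_id|exact: cvg_cst]|exact: cvg_cst].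
    by apply: cvgB; [exact: cvg_id|exact: cvg_cst].
  exact: closed_le.
pose q0 : T := (y0, ys0).
have kball : compact (ball q0).
  apply: (subclosed_compact (cball q0) (@compact_enorm_le _ _ y0 (enorm (p - h *: ys0 - y0)))).
  move=> x /= xq; have [-> |xy] := eqVneq (enorm (x - y0)) 0; first exact: enorm_ge0.
  have xy0 : 0 < enorm (x - y0) by rewrite lt_def xy enorm_ge0.
  rewrite -(ler_pM2r xy0) -expr2 sqr_enorm; apply: le_trans (dot_le _ _).
  rewrite -subr_le0 -dotBl; apply: le_trans xq; rewrite le_eqVlt; apply/orP; left.
  by apply/eqP; congr (dot _ _); apply/rowP => i; rewrite !mxE /=; ring.
have : \bigcap_(q in [set q : T | A q.1 q.2]) (ball q0 `&` ball q) !=set0.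
  move: kball; rewrite compact_In0; apply.
    by exists ball.
  move=> D sD; pose s := q0 :: finmap.enum_fset D.
  have As q : q \in s -> A q.1 q.2.
    by rewrite inE => /orP[/eqP -> //|qD]; have := sD q qD; rewrite inE.
  have mon (i j : 'I_(size s)) : 0 <= dot (h *: (nth q0 s i).2 - h *: (nth q0 s j).2)
      ((nth q0 s i).1 - (nth q0 s j).1).
    rewrite -scalerBr dotZl mulr_ge0 ?(ltW h0) //.
    by apply: hA.1; apply: As; exact: mem_nth.
  have [x hx] := @monotone_finite_resolvent (size s) (fun i => (nth q0 s i).1)
    (fun i => h *: (nth q0 s i).2) p mon.
  have xs q : q \in s -> ball q x.
    move=> qs; have qi : (index q s < size s)%N by rewrite index_mem.
    by have := hx (Ordinal qi); rewrite /= nth_index.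
  by exists x => q qD; split; apply: xs; rewrite inE ?eqxx // qD orbT.
move=> [x hx]; exists x, (h^-1 *: (p - x)); split; last first.
  by rewrite scalerA divff ?gt_eqF // scale1r addrC subrK.
apply: maximal_monotone_mem => y ys Ay; have [_ /= xq] := hx (y, ys) Ay.
have -> : h^-1 *: (p - x) - ys = - h^-1 *: (x - p + h *: ys).
  by apply/rowP => i; rewrite !mxE; field; rewrite gt_eqF.
by rewrite dotZl mulNr -mulrN mulr_ge0 ?invr_ge0 ?(ltW h0) // oppr_ge0.
Qed.

End Op.
End Minty.

(** * Almost everywhere differentiability of Lipschitz functions *)

Section LipschitzDerivable.
Variable R : realType.
Notation lam := (@lebesgue_measure R).

(** Covering a set by half-open intervals of small total length covers it by
    intervals of small total [G]-variation. *)
Lemma stieltjes_lipschitz_null (G : cumulative R R) (k : R) (N : set R) :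
  0 <= k -> (forall s t, s <= t -> G t - G s <= k * (t - s)) ->
  lam N = 0%E -> lebesgue_stieltjes_measure G N = 0%E.
Proof.
move=> k0 Glip N0; apply/eqP; rewrite eq_le measure_ge0 andbT.
apply/lee_addgt0Pr => e e0; rewrite add0e.
have k1 : 0 < k + 1 by rewrite ltr_wpDl.
have : (lam N < (e / (k + 1))%:E)%E by rewrite N0 lte_fin divr_gt0.
move=> /ereal_inf_lt[_ [I [mI NI] <-]] sI.
apply: (@le_trans _ _ (\sum_(i <oo) wlength G (I i))%E).
  by apply: ereal_inf_lbound; exists I.
apply: (@le_trans _ _ (\sum_(i <oo) (k%:E * wlength idfun (I i)))%E).
  apply: lee_nneseries => [i _ _|i _]; first exact: wlength_ge0.
  have /ocitvP[->|[[a b] /= ab ->]] := mI i; first by rewrite !wlength0 mule0.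
  by rewrite !wlength_itv_bnd ?(ltW ab) // -EFinM lee_fin; apply/Glip/ltW.
rewrite nneseriesZl; last by move=> i _; exact: wlength_ge0.
apply: (@le_trans _ _ (k%:E * (e / (k + 1))%:E)%E).
  by apply: lee_wpmul2l; [rewrite lee_fin|exact: ltW].
rewrite -EFinM lee_fin mulrA ler_pdivrMr // mulrC ler_wpM2l ?(ltW e0) //; lra.
Qed.

(** On a bounded interval the Stieltjes measure of [G] is finite and absolutely
    continuous; up to a constant [G] is the integral of its density. *)
Lemma cumulative_lipschitz_derivable_ae (G : cumulative R R) (k m : R) :
  0 <= k -> (forall s t, s <= t -> G t - G s <= k * (t - s)) ->
  {ae lam, forall t, - m < t < m -> derivable G t 1}.
Proof.
move=> k0 Glip.
have [m0|m0] := leP m 0.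
  by apply: nearW => t /andP[h1 h2]; exfalso; lra.
have mm : - m <= m by lra.
pose D : set (measurableTypeR R) := `]- m, m]%classic.
have mD : measurable D by exact: measurable_itv.
have muG (t : R) : - m <= t ->
    lebesgue_stieltjes_measure G `]- m, t]%classic = (G t - G (- m))%:E.
  move=> mt; rewrite /lebesgue_stieltjes_measure /= /measure_extension.
  rewrite measurable_mu_extE /=; last exact: is_ocitv.
  by rewrite wlength_itv_bnd.
have fD : (lebesgue_stieltjes_measure G D < +oo)%E by rewrite muG // ltry.
pose nu := mfrestr mD fD.
have nudom : nu `<< lam.
  move=> N N0 A mA AN; have A0 := N0 A mA AN; rewrite /nu /mfrestr /mrestr.
  apply: (stieltjes_lipschitz_null k0 Glip).
  by apply: (@subset_measure0 _ _ _ _ _ A) => //; exact: measurableI.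
have [f [f0 ffin fint fE]] := radon_nikodym_sigma_finite nudom.
pose h := fine \o f.
have fh : EFin \o h = f by apply/funext => t; rewrite /= fineK.
have hint : lam.-integrable setT (EFin \o h) by rewrite fh.
have := @FTC1 R h (BRight (- m)) _ (open_integrable_locally openT hint).
case=> [y|]; first exact: (integrableS measurableT).
move=> B [mB B0 hB]; exists B; split => // t /= nt; apply: hB => /= ht; apply: nt.
move=> /andP[m1 m2].
have [|der _] := ht; first by rewrite lte_fin.
pose P y := (\int[lam]_(z in `]- m, y]) h z)%R.
have HG : {near t, P + cst (G (- m)) =1 G}.
  near=> y; rewrite fctE /P.
  have ym : - m <= y by apply/ltW; near: y; exact: lt_nbhsr.
  have ym' : y <= m by apply/ltW; near: y; exact: lt_nbhsl.
  have fy : integral lam `]- m, y]%classic (EFin \o h) = (G y - G (- m))%:E.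
    rewrite fh; apply: etrans (esym (fE _ _)) _; first exact: measurable_itv.
    rewrite -muG //; congr (lebesgue_stieltjes_measure _ _).
    apply/setIidl => z; rewrite /D /= !in_itv /= => /andP[-> zy] /=.
    exact: le_trans ym'.
  by rewrite /Rintegral fy /=; lra.
apply: (near_eq_derivable HG).
exact: (derivableD der (derivable_cst _ _ _)).
Unshelve. all: by end_near. Qed.

(** A Lipschitz function plus a steep linear function is nondecreasing. *)
Lemma lipschitz_derivable_ae (g : R -> R) (k : R) :
  (forall s t, `|g t - g s| <= k * `|t - s|) ->
  {ae lam, forall t, derivable g t 1}.
Proof.
move=> glip.
have k0 : 0 <= k.
  by have := glip 0 1; rewrite subr0 normr1 mulr1; apply: le_trans.
pose G0 t := g t + k * t.
have G0nd : nondecreasing G0.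
  move=> s t st; rewrite /G0; have := glip s t.
  by rewrite (@ger0_norm _ (t - s)) ?subr_ge0 // ler_norml => /andP[]; lra.
have G0lip s t : s <= t -> G0 t - G0 s <= (2 * k) * (t - s).
  move=> st; rewrite /G0; have := glip s t.
  by rewrite (@ger0_norm _ (t - s)) ?subr_ge0 // ler_norml => /andP[]; lra.
have gcont : continuous g.
  move=> t; apply/cvgrPdist_lt => e e0.
  have e'0 : 0 < e / (k + 1) by rewrite divr_gt0 // ltr_wpDl.
  have /cvgrPdist_lt /(_ _ e'0) := @cvg_id _ (nbhs t).
  apply: filterS => s; rewrite ltr_pdivlMr ?ltr_wpDl // mulrC; apply: le_lt_trans.
  by apply: le_trans (glip s t) _; rewrite ler_wpM2r // lerDl.
have G0rc : right_continuous G0.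
  apply: right_continuousW => t; apply: cvgD; first exact: gcont.
  by apply: cvgM; [exact: cvg_cst|exact: cvg_id].
pose G : cumulative R R := HB.pack G0 (isCumulative.Build R _ R G0 G0nd G0rc).
have k20 : 0 <= 2 * k by rewrite mulr_ge0.
have := @ae_foralln _ _ _ lam (fun m t => - m%:R < t < m%:R -> derivable G t 1)
  (fun m => @cumulative_lipschitz_derivable_ae G (2 * k) m%:R k20 G0lip).
apply: filterS => t ht.
have tm : - (Num.bound `|t|)%:R < t < (Num.bound `|t|)%:R.
  by rewrite -ltr_norml archi_boundP.
have := ht _ tm; rewrite (_ : g = G0 - (fun t => k * t)); last first.
  by apply/funext => s; rewrite /G0 !fctE; ring.
by move=> dG; apply: derivableB => //; apply: derivableM.
Qed.

Lemma derive_right_quotient (E : normedModType R) (f : R -> E) (t : R) :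
  derivable f t 1 ->
  h^-1 *: (f (t + h) - f t) @[h --> (0 : R)^'+] --> 'D_1 f t.
Proof.
move=> df; have := cvg_dnbhs_at_right df; rewrite -/('D_1 f t).
apply: cvg_trans; apply: near_eq_cvg; apply: nearW => h.
by rewrite /= [h *: 1]mulr1 (addrC t).
Qed.

End LipschitzDerivable.

(** * The implicit Euler scheme *)

Section Euler.
Variables (R : realType) (n : nat) (A F : 'rV[R]_n -> set 'rV[R]_n) (L : R).
Hypotheses (hA : maximal_monotone A) (hF : lipschitz_cusco L F).

Lemma lipschitz_cusco_select x y v : F x v ->
  exists2 w, F y w & enorm (v - w) <= `|L| * enorm (x - y).
Proof.
move=> Fv; have [w Fw [b /= b1 vE]] := hF.2 x y v Fv.
exists w => //; rewrite -vE [w + _]addrC addrK enormZ normrM.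
rewrite (ger0_norm (enorm_ge0 _)) -[leRHS]mulr1.
by rewrite ler_wpM2l // mulr_ge0 // enorm_ge0.
Qed.

(** The velocity [h^-1 (x' - x)] is taken in [v - A x'] at the new point, and
    the next element of [F] is chosen close to the previous one: this makes the
    selection along the scheme Lipschitz in time. *)
Definition euler_step (h : R) (q q' : 'rV[R]_n * 'rV[R]_n) :=
  [/\ A q'.1 (q.2 - h^-1 *: (q'.1 - q.1)), F q'.1 q'.2 &
      enorm (q'.2 - q.2) <= `|L| * enorm (q'.1 - q.1)].

Lemma euler_scheme (h : R) x0 v : 0 < h -> setval_dom A x0 -> F x0 v ->
  exists q : nat -> 'rV[R]_n * 'rV[R]_n,
    [/\ q 0%N = (x0, v), forall k, F (q k).1 (q k).2 &
        forall k, euler_step h (q k) (q k.+1)].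
Proof.
move=> h0 Ax0 Fv.
have [next nextP] : {next & forall q : 'rV[R]_n * 'rV[R]_n, F q.1 q.2 ->
    euler_step h q (next q)}.
  apply: (@choice _ _ (fun q q' => F q.1 q.2 -> euler_step h q q')) => q.
  have [Fq|nFq] := pselect (F q.1 q.2); last by exists q.
  have [x [xs [Axs xE]]] := resolvent_total hA (q.1 + h *: q.2) h0 (ex_intro _ _ Ax0).
  have [w Fw wle] := lipschitz_cusco_select x Fq.
  exists (x, w) => _; split => //=; last by rewrite enormB (enormB x).
  suff -> : q.2 - h^-1 *: (x - q.1) = xs by [].
  have -> : x = q.1 + h *: q.2 - h *: xs by rewrite -xE addrK.
  by apply/rowP => i; rewrite !mxE; field; rewrite gt_eqF.
exists (fun k => iter k next (x0, v)).
have Fit k : F (iter k next (x0, v)).1 (iter k next (x0, v)).2.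
  by elim: k => //= k IH; have [] := nextP _ IH.
by split=> // k; exact: nextP.
Qed.

Section Scheme.
Variables (h : R) (x0 a0 v : 'rV[R]_n) (q : nat -> 'rV[R]_n * 'rV[R]_n).
Hypotheses (h0 : 0 < h) (Aa0 : A x0 a0) (q0 : q 0%N = (x0, v)).
Hypothesis qS : forall k, euler_step h (q k) (q k.+1).
Let u k := h^-1 *: ((q k.+1).1 - (q k).1).

(** Monotonicity makes the velocities nearly nonincreasing: each one exceeds
    the previous one by at most the change of the element of [F], itself at
    most [|L| h] times the previous velocity. *)
Lemma euler_velocity_le k :
  enorm (u k) <= (1 + `|L| * h) ^+ k * enorm (v - a0).
Proof.
have uE j : (q j.+1).1 - (q j).1 = h *: u j.
  by rewrite /u scalerA divff ?gt_eqF // scale1r.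
(* monotonicity along one step: [w] is the previous velocity, [d] the change
   of the element of [F] *)
have step j d w : 0 <= dot (d + w - u j) (h *: u j) ->
    enorm (u j) <= enorm d + enorm w.
  rewrite dotZr pmulr_rge0 // dotBl subr_ge0 -sqr_enorm => hu.
  have [->|uj] := eqVneq (enorm (u j)) 0; first by rewrite addr_ge0 ?enorm_ge0.
  have uj0 : 0 < enorm (u j) by rewrite lt_def uj enorm_ge0.
  rewrite -(ler_pM2r uj0) -expr2 (le_trans hu) // (le_trans (dot_le _ _)) //.
  by rewrite ler_wpM2r ?enorm_ge0 // enormD.
elim: k => [|k IH].
  rewrite expr0 mul1r; have [+ _ _] := qS 0; rewrite -/(u 0) => Ax1.
  have := hA.1 _ _ _ _ Ax1 Aa0; rewrite -{1}[x0]/((x0, v).1) -q0 uE => m.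
  have -> : enorm (v - a0) = enorm (0 : 'rV[R]_n) + enorm (v - a0).
    by rewrite enorm0 add0r.
  by apply: step; rewrite add0r; move: m; rewrite q0 /= addrAC.
have [+ _ _] := qS k.+1; rewrite -/(u k.+1) => Ax2.
have [+ _ df] := qS k; rewrite -/(u k) => Ax1.
have := hA.1 _ _ _ _ Ax2 Ax1; rewrite uE => m.
have : enorm (u k.+1) <= enorm ((q k.+1).2 - (q k).2) + enorm (u k).
  apply: step; apply: le_trans m _; rewrite le_eqVlt; apply/orP; left; apply/eqP.
  by congr (dot _ _); apply/rowP => i; rewrite !mxE; ring.
move: df; rewrite uE enormZ (gtr0_norm h0) => df ule.
apply: (@le_trans _ _ ((1 + `|L| * h) * enorm (u k))); first by move: df ule; lra.
by rewrite exprS -mulrA ler_wpM2l // addr_ge0 // mulr_ge0 // ltW.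
Qed.

Lemma euler_speed_le k (T : R) : k%:R * h <= T ->
  enorm (u k) <= expR (`|L| * T) * enorm (v - a0).
Proof.
move=> kT; apply: le_trans (euler_velocity_le k) _.
rewrite ler_wpM2r ?enorm_ge0 //.
apply: (@le_trans _ _ (expR (`|L| * h) ^+ k)).
  by apply: lerXn2r; rewrite ?nnegrE ?expR_ge0 ?expR_ge1Dx // addr_ge0 // mulr_ge0 // ltW.
rewrite -expRM_natl ler_expR mulrCA ler_wpM2l //.
Qed.

Lemma euler_lipschitz (j k : nat) (T : R) : (j <= k)%N -> k%:R * h <= T ->
  enorm ((q k).1 - (q j).1) <= expR (`|L| * T) * enorm (v - a0) * (h * (k - j)%:R)
  /\ enorm ((q k).2 - (q j).2) <=
     `|L| * (expR (`|L| * T) * enorm (v - a0) * (h * (k - j)%:R)).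
Proof.
move=> /subnK <-; move: (k - j)%N => m; rewrite addnK.
set M := expR _ * _; elim: m => [|m IH] mT.
  by rewrite !subrr enorm0 mulr0 mulr0 mulr0.
have mT' : (m + j)%:R * h <= T.
  by apply: le_trans mT; rewrite ler_wpM2r ?(ltW h0) // ler_nat addSn.
have [IH1 IH2] := IH mT'.
have step : enorm ((q (m + j).+1).1 - (q (m + j)).1) <= M * h.
  have := euler_speed_le mT'; rewrite /u enormZ gtr0_norm ?invr_gt0 //.
  by rewrite mulrC ler_pdivrMr.
have [_ _ df] := qS (m + j).
have df' : enorm ((q (m + j).+1).2 - (q (m + j)).2) <= `|L| * (M * h).
  by apply: le_trans df _; rewrite ler_wpM2l.
have -> : h * m.+1%:R = h * m%:R + h by rewrite -(natr1 m); ring.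
rewrite addSn !(mulrDr, mulrDl); split.
  by apply: le_trans (enorm_triangle (q (m + j)).1 _ _) _; rewrite addrC lerD.
by apply: le_trans (enorm_triangle (q (m + j)).2 _ _) _; rewrite addrC lerD.
Qed.

(** Summed over the steps, [<f - u - ys, x - y> >= 0] bounds the growth of
    [|x - y|^2 / 2]; in this form it survives a limit in which velocities do
    not converge. *)
Lemma euler_energy (j k : nat) (B : R) y ys : (j <= k)%N -> A y ys ->
  (forall i, (j <= i < k)%N -> dot ((q i).2 - ys) ((q i.+1).1 - y) <= B) ->
  (enorm ((q k).1 - y) ^+ 2 - enorm ((q j).1 - y) ^+ 2) / 2 <= h * (k - j)%:R * B.
Proof.
move=> /subnK <-; move: (k - j)%N => m Ay; rewrite addnK.
elim: m => [|m IH] hB; first by rewrite subrr mul0r mulr0 mul0r.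
have : (enorm ((q (m + j)).1 - y) ^+ 2 - enorm ((q j).1 - y) ^+ 2) / 2 <= h * m%:R * B.
  by apply: IH => i /andP[ji im]; apply: hB; rewrite ji addSn ltnS ltnW.
have Bm : dot ((q (m + j)).2 - ys) ((q (m + j).+1).1 - y) <= B.
  by apply: hB; rewrite leq_addl addSn ltnS leqnn.
have [Aq _ _] := qS (m + j); have := hA.1 _ _ _ _ Aq Ay.
set x' := (q (m + j).+1).1; set x := (q (m + j)).1; set f := (q (m + j)).2.
rewrite -addrA (addrC (- _)) addrA dotBl subr_ge0 dotZl => m1.
have {}m1 : dot (x' - x) (x' - y) <= h * B.
  rewrite mulrC -ler_pdivrMr // mulrC; exact: le_trans m1 Bm.
rewrite -(natr1 m) mulrDr mulr1 mulrDl => IHm.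
have : enorm (x' - y) ^+ 2 - enorm (x - y) ^+ 2 <= 2 * dot (x' - x) (x' - y).
  have := sqr_ge0 (enorm (x' - x)); rewrite !sqr_enorm.
  rewrite !(dotBl, dotBr) (dotC x x') (dotC y x) (dotC y x'); lra.
move: IHm m1; rewrite -/x; lra.
Qed.

End Scheme.
End Euler.

(** * Limits of Euler schemes *)

(** Limits along an ultrafilter exist at all times at once, which replaces the
    extraction of subsequences. *)
Lemma ultra_compact_cvg {T : Type} {U : set_system T} {UU : UltraFilter U}
    (X : topologicalType) (K : set X) (u : T -> X) :
  compact K -> (\forall t \near U, K (u t)) -> exists2 p, K p & u @ U --> p.
Proof.
move=> cK Ku; have [p [Kp clp]] := cK (u @ U) _ Ku.
exists p => // B pB; have [//|nB] := in_ultra_setVsetC (u @^-1` B) UU.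
by have [z []] := clp (~` B) B nB pB.
Qed.

Section Existence.
Variables (R : realType) (n : nat) (A F : 'rV[R]_n -> set 'rV[R]_n) (L : R).
Hypotheses (hA : maximal_monotone A) (hF : lipschitz_cusco L F).
Variables (x0 a0 v : 'rV[R]_n).
Hypotheses (Aa0 : A x0 a0) (Fv : F x0 v).

Let step N : R := N.+1%:R^-1.
Let step_gt0 N : 0 < step N. Proof. by rewrite invr_gt0. Qed.
Let idx N (t : R) := Num.truncn (t * N.+1%:R).

Let idx_le N t : 0 <= t -> (idx N t)%:R * step N <= t.
Proof.
move=> t0; rewrite ler_pdivrMr // truncn_le; by rewrite mulr_ge0.
Qed.

Let idx_gt N t : t < (idx N t)%:R * step N + step N.
Proof.
rewrite -[X in _ + X]mul1r -mulrDl natr1 ltr_pdivlMr //; exact: truncnS_gt.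
Qed.

(** Sampling the implicit Euler schemes of step [1/(N+1)] gives curves that are
    Lipschitz up to the step, uniformly in [N]; they converge pointwise along an
    ultrafilter, and the discrete estimates pass to the limit. The last clause
    is the integrated form of [f - x' \in A x]. *)
Lemma euler_limit : exists x f : R -> 'rV[R]_n,
  [/\ x 0 = x0, f 0 = v, forall t, 0 <= t -> F (x t) (f t),
      forall T, exists2 M, 0 <= M & forall s t, 0 <= s -> s <= t -> t <= T ->
        enorm (x t - x s) <= M * (t - s)
    & forall T t y ys, 0 <= t -> A y ys -> exists K, forall h, 0 <= h -> t + h <= T ->
        (enorm (x (t + h) - y) ^+ 2 - enorm (x t - y) ^+ 2) / 2 <=
        h * (dot (f t - ys) (x t - y) + K * h)].
Proof.
have /choice[Q QP] : forall N, exists q : nat -> 'rV[R]_n * 'rV[R]_n,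
    [/\ q 0%N = (x0, v), forall k, F (q k).1 (q k).2 &
        forall k, euler_step A F L (step N) (q k) (q k.+1)].
  by move=> N; apply: euler_scheme => //; exists a0.
pose xN N t := (Q N (idx N t)).1; pose fN N t := (Q N (idx N t)).2.
pose M T := expR (`|L| * T) * enorm (v - a0).
have M0 T : 0 <= M T by rewrite mulr_ge0 ?expR_ge0 ?enorm_ge0.
have stepN N := @step_gt0 N.
have idxS N s t : s <= t -> (idx N s <= idx N t)%N.
  by move=> st; apply: le_truncn; rewrite ler_wpM2r.
have idxB N s t : 0 <= s -> s <= t ->
    t - s - step N <= step N * (idx N t - idx N s)%:R <= t - s + step N.
  move=> s0 st; rewrite natrB ?idxS // mulrBr ![step N * _]mulrC.
  have := idx_le N s0; have := idx_le N (le_trans s0 st).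
  have := idx_gt N s; have := idx_gt N t; lra.
have lipN N s t T : 0 <= s -> s <= t -> t <= T ->
    enorm (xN N t - xN N s) <= M T * (t - s + step N) /\
    enorm (fN N t - fN N s) <= `|L| * (M T * (t - s + step N)).
  move=> s0 st tT; have [q0 _ qS] := QP N.
  have kT : (idx N t)%:R * step N <= T by apply: le_trans tT; apply/idx_le/(le_trans s0).
  have [h1 h2] := euler_lipschitz hA (stepN N) Aa0 q0 qS (idxS N s t st) kT.
  have /andP[_ le] := idxB N s t s0 st.
  have h3 := ler_wpM2l (M0 T) le.
  by split; [exact: le_trans h1 _|apply: le_trans h2 _; rewrite ler_wpM2l].
have xN0 N : xN N 0 = x0 by rewrite /xN /idx mul0r truncn0; have [-> _ _] := QP N.
have fN0 N : fN N 0 = v by rewrite /fN /idx mul0r truncn0; have [-> _ _] := QP N.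
have step1 N : step N <= 1 by rewrite invf_le1 // ler1n.
have [U [UU U_oo]] := @ultraFilterLemma nat \oo _.
have step0 : step N @[N --> U] --> (0 : R).
  by apply: (cvg_trans _ (@cvg_harmonic R)) => B hB; apply: U_oo.
have xex t : exists p : 'rV[R]_n, 0 <= t -> xN N t @[N --> U] --> p.
  have [t0|] := leP 0 t; last by exists 0.
  have [|p _ hp] := @ultra_compact_cvg _ U _ _ _ (fun N => xN N t)
    (@compact_enorm_le _ _ x0 (M t * (t + 1))); last by exists p.
  apply: nearW => N /=; rewrite -[x0](xN0 N).
  have [h1 _] := lipN N 0 t t (lexx _) t0 (lexx _).
  by apply: le_trans h1 _; rewrite subr0 ler_wpM2l // lerD2l.
have fex t : exists p : 'rV[R]_n, 0 <= t -> fN N t @[N --> U] --> p.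
  have [t0|] := leP 0 t; last by exists 0.
  have [|p _ hp] := @ultra_compact_cvg _ U _ _ _ (fun N => fN N t)
    (@compact_enorm_le _ _ v (`|L| * (M t * (t + 1)))); last by exists p.
  apply: nearW => N /=; rewrite -[v](fN0 N).
  have [_ h1] := lipN N 0 t t (lexx _) t0 (lexx _).
  by apply: le_trans h1 _; rewrite subr0 ler_wpM2l // ler_wpM2l // lerD2l.
have [x xP] := choice xex; have [f fP] := choice fex.
have uniq_lim (p p' : 'rV[R]_n) : (fun=> p) @ U --> p' -> p' = p.
  by move=> pp'; apply: (@cvg_unique _ _ (p @[_ --> U])) => //; exact: cvg_cst.
exists x, f; split.
- apply: uniq_lim; have := xP 0 (lexx _).
  by rewrite (_ : (fun N => xN N 0) = fun=> x0) //; apply/funext => N.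
- apply: uniq_lim; have := fP 0 (lexx _).
  by rewrite (_ : (fun N => fN N 0) = fun=> v) //; apply/funext => N.
- move=> t t0; have [_ _ cF] := hF.1 (x t).
  have clF : closed (F (x t)) by apply: compact_closed cF; exact: norm_hausdorff.
  have close N : exists2 w, F (x t) w & enorm (fN N t - w) <= `|L| * enorm (xN N t - x t).
    by apply: (lipschitz_cusco_select hF); have [_ + _] := QP N; apply.
  have [w Fw wle] : exists2 w : nat -> 'rV[R]_n, (forall N, F (x t) (w N)) &
      forall N, enorm (fN N t - w N) <= `|L| * enorm (xN N t - x t).
    have /choice[w wP] : forall N, exists w, F (x t) w /\
        enorm (fN N t - w) <= `|L| * enorm (xN N t - x t).
      by move=> N; have [w] := close N; exists w.
    by exists w => N; have [] := wP N.
  have wf : w N @[N --> U] --> f t.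
    apply/cvg_enormP => e e0.
    have e1 : 0 < e / 2 by rewrite divr_gt0.
    have e2 : 0 < e / 2 / (`|L| + 1) by rewrite divr_gt0 // ltr_wpDl.
    have /cvg_enormP hx := xP t t0; have /cvg_enormP hf := fP t t0.
    apply: filterS2 (hx _ e2) (hf _ e1) => N.
    rewrite ltr_pdivlMr ?ltr_wpDl // => xe fe.
    apply: le_lt_trans (enorm_triangle (fN N t) _ _) _.
    rewrite (enormB (w N)); have := wle N.
    have := enorm_ge0 (xN N t - x t); nra.
  by apply: (@closed_cvg _ _ U _ w (F (x t)) clF _ _ wf); apply: nearW.
- move=> T; exists (M T) => // s t s0 st tT.
  apply: (@ler_cvg_to _ U _ _ (fun N => enorm (xN N t - xN N s))
    (fun N => M T * (t - s + step N))).
  + by apply: cvg_enorm; apply: cvgB; apply: xP => //; exact: le_trans st.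
  + rewrite -[X in _ --> M T * X]addr0; apply: cvgM; first exact: cvg_cst.
    by apply: cvgD => //; exact: cvg_cst.
  + by apply: nearW => N; have [] := lipN N s t T s0 st tT.
- move=> T t y ys t0 Ay.
  pose M' := (1 + `|L|) * M T.
  have M'0 : 0 <= M' by rewrite mulr_ge0 // addr_ge0.
  pose B (p q : 'rV[R]_n) (D : R) : R := dot p q + (enorm p + enorm q) * D + D ^+ 2.
  pose p := f t - ys; pose q := x t - y.
  exists ((enorm p + enorm q) * M' + M' ^+ 2 * `|T|) => h h0 thT.
  have th0 : 0 <= t + h by rewrite addr_ge0.
  apply: (@le_trans _ R (h * B p q (M' * h))); last first.
    rewrite ler_wpM2l // /B -addrA lerD2l [leRHS]mulrDl lerD //; first by rewrite mulrA.
    rewrite exprMn -[leRHS]mulrA ler_wpM2l ?sqr_ge0 // [h ^+ 2]expr2 ler_wpM2r //.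
    by rewrite (le_trans _ (ler_norm _)) // (le_trans _ thT) // lerDr.
  pose pN N := fN N t - ys; pose qN N := xN N t - y.
  pose D N := M' * (h + step N).
  have cp : pN N @[N --> U] --> p by apply: cvgB; [exact: fP|exact: cvg_cst].
  have cq : qN N @[N --> U] --> q by apply: cvgB; [exact: xP|exact: cvg_cst].
  have cD : D N @[N --> U] --> M' * h.
    rewrite -[X in _ --> M' * X]addr0; apply: cvgM; first exact: cvg_cst.
    by apply: cvgD => //; exact: cvg_cst.
  have cB : B (pN N) (qN N) (D N) @[N --> U] --> B p q (M' * h).
    apply: cvgD; last by rewrite expr2; apply: cvgM.
    apply: cvgD; first exact: cvg_dot.
    by apply: cvgM => //; apply: cvgD; exact: cvg_enorm.
  apply: (@ler_cvg_to _ U _ _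
    (fun N => (enorm (xN N (t + h) - y) ^+ 2 - enorm (qN N) ^+ 2) / 2)
    (fun N => h * B (pN N) (qN N) (D N) + step N * `|B (pN N) (qN N) (D N)|)).
  + apply: cvgM; last exact: cvg_cst.
    have csq (z : nat -> 'rV[R]_n) (l : 'rV[R]_n) : z @ U --> l ->
        enorm (z N) ^+ 2 @[N --> U] --> enorm l ^+ 2.
      by move=> zl; rewrite expr2; apply: cvgM; exact: cvg_enorm.
    by apply: cvgB; apply: csq => //; apply: cvgB; [exact: xP|exact: cvg_cst].
  + rewrite -[X in _ --> X]addr0 -(mul0r `|B p q (M' * h)|).
    apply: cvgD; first by apply: cvgM => //; exact: cvg_cst.
    by apply: cvgM => //; exact: cvg_norm.
  + apply: nearW => N; have [q0 _ qS] := QP N.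
    have tth : t <= t + h by rewrite lerDl.
    have /andP[le1 le2] := idxB N t (t + h) t0 tth.
    have kT : (idx N (t + h))%:R * step N <= T by apply: le_trans thT; exact: idx_le.
    apply: (@le_trans _ _ (step N * (idx N (t + h) - idx N t)%:R * B (pN N) (qN N) (D N))).
      apply: (euler_energy hA (stepN N) qS (idxS N t _ tth) Ay) => i /andP[ti ih].
      have iT : i.+1%:R * step N <= T.
        by apply: le_trans kT; rewrite ler_wpM2r ?(ltW (stepN N)) // ler_nat.
      have iT' : i%:R * step N <= T.
        by apply: le_trans iT; rewrite ler_wpM2r ?(ltW (stepN N)) // ler_nat.
      have [_ df] := euler_lipschitz hA (stepN N) Aa0 q0 qS ti iT'.
      have [dx _] := euler_lipschitz hA (stepN N) Aa0 q0 qS (leq_trans ti (leqnSn i)) iT.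
      have im (j : nat) : (j <= idx N (t + h))%N -> step N * (j - idx N t)%:R <= h + step N.
        move=> jt; apply: (@le_trans _ _ (step N * (idx N (t + h) - idx N t)%:R)).
          by rewrite ler_wpM2l ?(ltW (stepN N)) // ler_nat leq_sub2r.
        by move: le2; lra.
      have MD j : (j <= idx N (t + h))%N -> M T * (step N * (j - idx N t)%:R) <= D N /\
          `|L| * (M T * (step N * (j - idx N t)%:R)) <= D N.
        move=> /im jm; have a1 := M0 T; have a2 := normr_ge0 L.
        have a3 : 0 <= step N * (j - idx N t)%:R by rewrite mulr_ge0 // ltW.
        have b1 : M T * (step N * (j - idx N t)%:R) <= M T * (h + step N) by rewrite ler_wpM2l.
        have b0 : 0 <= M T * (h + step N) by rewrite mulr_ge0 // (le_trans a3).
        have b2 : `|L| * (M T * (step N * (j - idx N t)%:R)) <= `|L| * (M T * (h + step N)).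
          by rewrite ler_wpM2l.
        have b3 : 0 <= `|L| * (M T * (h + step N)) by rewrite mulr_ge0.
        by rewrite /D /M' -mulrA mulrDl mul1r; lra.
      have {}df : enorm ((Q N i).2 - fN N t) <= D N.
        by apply: le_trans df _; have [] := MD i (ltnW ih).
      have {}dx : enorm ((Q N i.+1).1 - xN N t) <= D N.
        by apply: le_trans dx _; have [] := MD i.+1 ih.
      have -> : (Q N i).2 - ys = ((Q N i).2 - fN N t) + pN N.
        by rewrite /pN addrA subrK.
      have -> : (Q N i.+1).1 - y = ((Q N i.+1).1 - xN N t) + qN N.
        by rewrite /qN addrA subrK.
      move: dx df; move: ((Q N i).2 - fN N t) ((Q N i.+1).1 - xN N t) => dF dX dx df.
      move: (pN N) (qN N) (D N) dx df => P Z E dx df.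
      have l1 := le_trans (dot_le dF dX) (ler_pM (enorm_ge0 _) (enorm_ge0 _) df dx).
      have l2 := le_trans (dot_le dF Z) (ler_wpM2r (enorm_ge0 _) df).
      have l3 := le_trans (dot_le P dX) (ler_wpM2l (enorm_ge0 _) dx).
      by rewrite /B dotDl !dotDr expr2; lra.
    move: (B (pN N) (qN N) (D N)) => b.
    move: le1 le2; set r := step N * _ => le1 le2.
    have : (r - h) * b <= step N * `|b|.
      apply: le_trans (ler_norm _) _; rewrite normrM ler_wpM2r //.
      by rewrite ler_norml; lra.
    lra.
Qed.

End Existence.

(** * Solutions with prescribed initial element of F *)

Section Solution.
Variables (R : realType) (n : nat) (A F : 'rV[R]_n -> set 'rV[R]_n) (L : R).
Hypotheses (hA : maximal_monotone A) (hF : lipschitz_cusco L F).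

(** The energy estimate [d/dt |x - y|^2 / 2 <= <f - ys, x - y>] says that
    [(x, f - w)] is monotonically related to the graph of [A] for every limit
    [w] of right difference quotients, and maximality concludes. *)
Lemma energy_quotient (x : R -> 'rV[R]_n) (t : R) (f w : 'rV[R]_n)
    (G : set_system R) :
  ProperFilter G -> 0^'+ `<=` G ->
  (forall y ys, A y ys -> exists K, \forall h \near 0^'+,
     (enorm (x (t + h) - y) ^+ 2 - enorm (x t - y) ^+ 2) / 2 <=
     h * (dot (f - ys) (x t - y) + K * h)) ->
  h^-1 *: (x (t + h) - x t) @[h --> G] --> w -> A (x t) (f - w).
Proof.
move=> PG G0 energy quot; apply: maximal_monotone_mem => // y ys Ay.
have [K KP] := energy _ _ Ay.
have h_cvg : (h : R) @[h --> G] --> (0 : R).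
  by apply: (cvg_trans (G := 0^'+)) => //; apply: cvg_within.
suff : dot w (x t - y) <= dot (f - ys) (x t - y) by rewrite !(dotBl, dotBr); lra.
apply: (@ler_cvg_to _ G _ _ (fun h => dot (h^-1 *: (x (t + h) - x t)) (x t - y))
  (fun h => dot (f - ys) (x t - y) + K * h)).
- by apply: cvg_dot => //; exact: cvg_cst.
- rewrite -[X in _ --> X]addr0 -[in X in _ --> X](mulr0 K).
  by apply: cvgD; [exact: cvg_cst|apply: cvgM => //; exact: cvg_cst].
- have h_gt0 : \forall h \near G, 0 < h by apply: G0; exact: nbhs_right_gt.
  apply: filterS2 (G0 _ KP) h_gt0 => h hK h0.
  rewrite dotZl mulrC ler_pdivrMr // mulrC; apply: le_trans hK.
  rewrite -[x (t + h) - y](subrK (x t - y))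
    (sqr_enormD (x (t + h) - y - (x t - y))).
  have -> : x (t + h) - y - (x t - y) = x (t + h) - x t.
    by rewrite opprB addrA subrK.
  by have := sqr_ge0 (enorm (x (t + h) - x t)); lra.
Qed.

(** The last clause expresses, without differentiability at [0], that the right
    velocities at [0] lie in [v - A x0] for the prescribed [v]. *)
Lemma exists_solution x0 v : setval_dom A x0 -> F x0 v ->
  exists2 x, is_solution A F x0 x &
    exists2 M, (forall t, 0 <= t -> t <= 1 -> enorm (x t - x0) <= M * t) &
      forall (G : set_system R) (w : 'rV[R]_n), ProperFilter G -> 0^'+ `<=` G ->
        h^-1 *: (x h - x0) @[h --> G] --> w -> A x0 (v - w).
Proof.
move=> [a0 Aa0] Fv.
have [x1 [f [x10 f0 Ff lip energy]]] := euler_limit hA hF Aa0 Fv.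
pose x t := x1 (Num.max t 0).
have xE t : 0 <= t -> x t = x1 t by move=> t0; rewrite /x max_l.
have xlip T : exists2 M, 0 <= M & forall s t, s <= t -> t <= T ->
    enorm (x t - x s) <= M * (t - s).
  have [M M0 hM] := lip (Num.max T 0); exists M => // s t st tT.
  rewrite /x; apply: le_trans (hM _ _ _ _ _) _.
  - by rewrite le_max lexx orbT.
  - by rewrite ge_max !le_max st lexx !orbT.
  - by rewrite ge_max !le_max tT lexx !orbT.
  rewrite ler_wpM2l //; have [s0|s0] := leP s 0; have [t0|t0] := leP t 0; lra.
have xlip' T : exists2 M, 0 <= M & forall s t, s <= T -> t <= T ->
    enorm (x t - x s) <= M * `|t - s|.
  have [M M0 hM] := xlip T; exists M => // s t sT tT.
  have [st|ts] := leP s t; first by rewrite ger0_norm ?subr_ge0 // hM.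
  by rewrite enormB distrC ger0_norm ?subr_ge0 ?(ltW ts) // hM // ltW.
have incl t (w : 'rV[R]_n) (G : set_system R) : 0 <= t -> ProperFilter G -> 0^'+ `<=` G ->
    h^-1 *: (x (t + h) - x t) @[h --> G] --> w -> A (x t) (f t - w).
  move=> t0 PG G0; apply: energy_quotient => // y ys Ay.
  have [K hK] := energy (t + 1) _ _ _ t0 Ay; exists K.
  have h1 : \forall h \near (0 : R)^'+, h < 1 by exact: nbhs_right_lt.
  have h2 : \forall h \near (0 : R)^'+, 0 < h by exact: nbhs_right_gt.
  apply: filterS2 h1 h2 => h h1 h2; rewrite !xE ?addr_ge0 ?(ltW h2) //.
  by apply: hK; [exact: ltW|rewrite lerD2l ltW].
exists x; last first.
  have [M M0 hM] := xlip 1; exists M.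
    by move=> t t0 t1; have := hM 0 t t0 t1; rewrite (xE 0) // x10 subr0.
  move=> G w PG G0 quot; rewrite -x10 -f0 -xE //; apply: (incl 0 w G) => //.
  rewrite xE // x10; apply: cvg_trans quot; apply: near_eq_cvg.
  by apply: nearW => h; rewrite add0r.
have xcont : continuous x.
  move=> t; apply/cvg_enormP => e e0.
  have [M M0 hM] := xlip' (t + 1).
  have e'0 : 0 < e / (M + 1) by rewrite divr_gt0 // ltr_wpDl.
  have [near1 near2] : (\forall s \near t, `|t - s| < 1) /\
      (\forall s \near t, `|t - s| < e / (M + 1)).
    by split; exact: (@cvgr_dist_lt _ _ _ (nbhs t) _ id t cvg_id).
  apply: filterS2 near1 near2 => s s1; rewrite ltr_pdivlMr ?ltr_wpDl // => s2.
  have sT : s <= t + 1 by move: s1; rewrite ltr_norml; lra.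
  apply: le_lt_trans (hM _ _ _ sT) (le_lt_trans _ s2); first by lra.
  by rewrite distrC mulrC ler_wpM2l // lerDl.
split.
- exact: continuous_subspaceT.
- move=> K cK _ e e0.
  have [T hT] : exists T, forall t, K t -> t <= T.
    have [B [_ hB]] := compact_bounded cK; exists (B + 1) => t Kt.
    by apply: le_trans (ler_norm t) (hB _ _ _ Kt); rewrite ltrDl.
  have [M M0 hM] := xlip T.
  exists (e / (M + 1)); first by rewrite divr_gt0 // ltr_wpDl.
  move=> m s t hst _; rewrite ltr_pdivlMr ?ltr_wpDl // => hlt.
  apply: le_lt_trans hlt; rewrite mulr_suml; apply: ler_sum => i _.
  have [Ks Kt st] := hst i.
  apply: le_trans (hM _ _ st (hT _ Kt)) _; rewrite mulrC ler_wpM2l ?subr_ge0 //.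
  by rewrite lerDl.
- by rewrite xE.
have coord_ae (m : nat) : \forall t \ae (@lebesgue_measure R), forall i : 'I_n,
    derivable (fun s : R => x (Num.min s m%:R) 0 i : R) (t : R) 1.
  apply: filter_forall => i; have [M M0 hM] := xlip' m%:R.
  apply: (@lipschitz_derivable_ae _ _ M) => s t.
  apply: (@le_trans _ _ (enorm (x (Num.min t m%:R) - x (Num.min s m%:R)))).
    by have := coord_le_enorm (x (Num.min t m%:R) - x (Num.min s m%:R)) i; rewrite !mxE.
  apply: le_trans (hM _ _ _ _) _; rewrite ?ge_min ?lexx ?orbT //.
  rewrite ler_wpM2l // ler_norml.
  have [h1|h1] := leP 0 (t - s); rewrite ?(ger0_norm h1) ?(ltr0_norm h1);
    case: (leP t m%:R) => h2; case: (leP s m%:R) => h3; lra.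
have neq0 : \forall t \ae (@lebesgue_measure R), (t : R) <> 0.
  exists [set 0]; split => //; first exact: lebesgue_measure_set1.
  by move=> t /= /contrapT.
apply: filterS2 (ae_foralln coord_ae) neq0 => t dt tn0 t0.
have {tn0 t0} t0 : 0 < t by rewrite lt_def t0 andbT; apply/eqP.
have dx : derivable x t 1.
  apply/derivable_mxP => j i; rewrite ord1.
  have tb : t < (Num.bound `|t|)%:R by rewrite (le_lt_trans (ler_norm t)) // archi_boundP.
  apply: near_eq_derivable (dt (Num.bound `|t|) i).
  have near_t : \forall s \near t, s < (Num.bound `|t|)%:R by exact: lt_nbhsl.
  by apply: filterS near_t => s st; rewrite min_l // ltW.
split => //.
exists (f t); first by rewrite xE ?(ltW t0) //; apply: Ff; exact: ltW.
exists (f t - 'D_1 x t); last by rewrite opprB addrC subrK.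
apply: (incl t _ (0 : R)^'+) => //; first exact: ltW.
exact: derive_right_quotient.
Qed.

End Solution.

(** * Proximal and Frechet subdifferentials *)

Section Subdifferentials.
Variables (R : realType) (n : nat).
Implicit Types (V : 'rV[R]_n -> \bar R) (x y xi : 'rV[R]_n).

Lemma lt_limf_einf (f : 'rV[R]_n -> \bar R)
    (G : set_system 'rV[R]_n) (r : \bar R) :
  (r < limf_einf f G)%E -> exists2 B, G B & forall y, B y -> (r <= f y)%E.
Proof.
rewrite limf_einfE => /ereal_sup_gt[_ [B GB <-]] rB; exists B => // y By.
by apply: le_trans (ltW rB) _; apply: ereal_inf_lbound; exists y.
Qed.

Lemma limf_einf_ge (f : 'rV[R]_n -> \bar R)
    (G : set_system 'rV[R]_n) (r : \bar R) (B : set 'rV[R]_n) :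
  G B -> (forall y, B y -> (r <= f y)%E) -> (r <= limf_einf f G)%E.
Proof.
move=> GB rB; rewrite limf_einfE; apply: (@le_trans _ _ (ereal_inf (f @` B))).
  by apply: le_ereal_inf_tmp => _ [y By <-]; exact: rB.
by apply: ereal_sup_ubound; exists B.
Qed.

Lemma dnbhs_enormP x (B : set 'rV[R]_n) :
  (x^')%classic B <-> exists2 d, 0 < d & forall y, y != x -> enorm (y - x) < d -> B y.
Proof.
rewrite /dnbhs withinE; split.
  move=> [W xW BW]; have /cvg_enormP hid := @cvg_id _ (nbhs x).
  have /nbhs_ballP[d /= d0 dW] := xW.
  exists d => // y yx yd; have : (B `&` (fun y => y != x)) y; last by case.
  rewrite BW; split => //; apply: dW; rewrite -ball_normE /= distrC.
  exact: le_lt_trans (norm_le_enorm _) yd.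
move=> [d d0 dB]; exists [set y | enorm (y - x) < d \/ B y].
  have /cvg_enormP /(_ d d0) := @cvg_id _ (nbhs x).
  by apply: filterS => y yd; left.
apply/seteqP; split=> y [h1 h2]; split=> //; first by right.
by case: h1 => // h1; exact: dB.
Qed.

(** The quotients of both subdifferentials have the form below, with [c] a power
    of the distance; this turns their lower limits into inequalities for [V]. *)
Lemma diff_quotient_ge (Vy : \bar R) (vx d s c : R) : 0 < c ->
  ((- s)%:E <= (Vy - vx%:E - d%:E) * (c^-1)%:E)%E =
  ((vx + d - s * c)%:E <= Vy)%E.
Proof.
move=> c0; have ci0 : 0 < c^-1 by rewrite invr_gt0.
case: Vy => [r| |].
- rewrite -!EFinB -EFinM !lee_fin ler_pdivlMr // !lerBrDr !mulNr.
  by congr (_ <= _); ring.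
- by rewrite /= gt0_mulye ?lte_fin // !leey.
- by rewrite /= gt0_mulNye ?lte_fin.
Qed.

Lemma prox_subdiffP V x xi (vx : R) : V x = vx%:E ->
  prox_subdiff V x xi <-> exists s d, 0 < d /\
    forall y, enorm (y - x) < d ->
      ((vx + dot xi (y - x) - s * enorm (y - x) ^+ 2)%:E <= V y)%E.
Proof.
move=> Vx; have sq_gt0 y : y != x -> 0 < enorm (y - x) ^+ 2.
  by move=> yx; rewrite exprn_gt0 // enorm_gt0 // subr_eq0.
split=> [[_ lim]|[s [d [d0 hd]]]].
  have [s slim] : exists s : R, ((- s)%:E < limf_einf (fun y : 'rV[R]_n =>
       (V y - V x - (dot xi (y - x)%R)%:E) * ((enorm (y - x) ^+ 2)^-1)%:E)
       (x^')%classic)%E.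
    case: (limf_einf _ _) lim => [r| |] //= _; last by exists 0; exact: ltry.
    by exists (1 - r); rewrite lte_fin; lra.
  have [B /dnbhs_enormP[d d0 dB] Bs] := lt_limf_einf slim.
  exists s, d; split => // y yd.
  have [->|yx] := eqVneq y x; first by rewrite subrr dot0r enorm0 Vx expr0n mulr0 addr0 subr0.
  by have := Bs y (dB y yx yd); rewrite Vx diff_quotient_ge // sq_gt0.
split; first by rewrite /edom /= Vx ltry.
apply: (@lt_le_trans _ _ (- s)%:E); first exact: ltNyr.
apply: (@limf_einf_ge _ _ _ [set y | y != x /\ enorm (y - x) < d]).
  by apply/dnbhs_enormP; exists d.
by move=> y [yx yd]; rewrite Vx diff_quotient_ge ?sq_gt0 // hd.
Qed.

Lemma frechet_subdiffP V x xi (vx : R) : V x = vx%:E ->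
  frechet_subdiff V x xi <-> forall e, 0 < e -> exists2 d, 0 < d &
    forall y, enorm (y - x) < d ->
      ((vx + dot xi (y - x) - e * enorm (y - x))%:E <= V y)%E.
Proof.
move=> Vx; have e_gt0 y : y != x -> 0 < enorm (y - x).
  by move=> yx; rewrite enorm_gt0 // subr_eq0.
split=> [[_ lim] e e0|h].
  have : ((- e)%:E < 0)%E by rewrite lte_fin oppr_lt0.
  move=> /lt_le_trans /(_ lim) /lt_limf_einf[B /dnbhs_enormP[d d0 dB] Bs].
  exists d => // y yd.
  have [->|yx] := eqVneq y x; first by rewrite subrr dot0r enorm0 Vx mulr0 addr0 subr0.
  by have := Bs y (dB y yx yd); rewrite Vx diff_quotient_ge // e_gt0.
split; first by rewrite /edom /= Vx ltry.
apply/lee_subgt0Pr => e e0; rewrite sub0e -EFinN.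
have [d d0 hd] := h e e0.
apply: (@limf_einf_ge _ _ _ [set y | y != x /\ enorm (y - x) < d]).
  by apply/dnbhs_enormP; exists d.
by move=> y [yx yd]; rewrite Vx diff_quotient_ge ?e_gt0 // hd.
Qed.

Lemma prox_sub_frechet V x : (-oo < V x)%E -> prox_subdiff V x `<=` frechet_subdiff V x.
Proof.
move=> Vx xi pxi; have Vxy : (V x < +oo)%E by case: pxi.
have Vfin : V x = (fine (V x))%:E by rewrite fineK // fin_numE gt_eqF // lt_eqF.
have [s [d [d0 hd]]] := (prox_subdiffP xi Vfin).1 pxi.
apply/(frechet_subdiffP xi Vfin) => e e0.
have e1 : 0 < e / (`|s| + 1) by rewrite divr_gt0 // ltr_wpDl.
exists (Num.min d (e / (`|s| + 1))); first by rewrite lt_min d0.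
move=> y; rewrite lt_min => /andP[yd]; rewrite ltr_pdivlMr ?ltr_wpDl // => ye.
apply: le_trans (hd _ yd); rewrite lee_fin lerD2l lerN2 expr2 mulrA.
rewrite ler_wpM2r ?enorm_ge0 //.
have := ler_norm s; have := enorm_ge0 (y - x); have := normr_ge0 s; nra.
Qed.

End Subdifferentials.

Section Epigraph.
Variables (R : realType) (n : nat).
Implicit Types (V : 'rV[R]_n -> \bar R) (x y xi : 'rV[R]_n) (z b : R).

Lemma dot_row_mx (u u' : 'rV[R]_n) (a a' : 'rV[R]_1) :
  dot (row_mx u a) (row_mx u' a') = dot u u' + a 0 0 * a' 0 0.
Proof.
rewrite /dot big_split_ord /= big_ord1; congr (_ + _).
  by apply: eq_bigr => i _; rewrite !row_mxEl.
by rewrite !row_mxEr.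
Qed.

Lemma closed_epigraph V : lower_semicontinuous V -> closed (epigraph V).
Proof.
move=> lscV w clw; rewrite /epigraph /= leNgt; apply/negP => wV.
have [r /andP[wr rV]] : exists r : R, ((rsubmx w 0 0)%:E < r%:E < V (lsubmx w))%E.
  case: (V _) wV => [s| |] //=.
    rewrite lte_fin => ws; exists ((rsubmx w 0 0 + s) / 2).
    by rewrite !lte_fin; apply/andP; split; lra.
  by move=> _; exists (rsubmx w 0 0 + 1); rewrite ltry andbT lte_fin ltrDl.
have [B nB BV] := lscV _ _ rV.
have /nbhs_ballP[d1 /= d10 dB] := nB.
pose e := Num.min d1 (r - rsubmx w 0 0).
have e0 : 0 < e by rewrite lt_min d10 subr_gt0 -lte_fin.
have [w' [/= epi']] := clw _ (nbhsx_ballx w e e0).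
rewrite -ball_normE /= lt_min => /andP[ww' ww''].
have w'B : B (lsubmx w').
  apply: dB; rewrite -ball_normE /= -linearB; apply: le_lt_trans ww'.
  rewrite [leLHS]mx_normrE; apply/bigmax_leP; split => // -[i j] _ /=.
  by rewrite ord1 mxE coord_le_norm.
have w'r : rsubmx w' 0 0 < r.
  have := le_lt_trans (coord_le_norm (w - w') (rshift n 0)) ww''.
  by rewrite !mxE ltr_norml => /andP[]; lra.
have := lt_le_trans (BV _ w'B) epi'; rewrite lte_fin; lra.
Qed.

(** A projection on the epigraph of [V], written with pairs instead of vectors of
    dimension [n + 1] to keep the two components apart. *)
Definition epi_nearest V x z y b :=
  (V y <= b%:E)%E /\ forall y' b', (V y' <= b'%:E)%E ->
    enorm (x - y) ^+ 2 + (z - b) ^+ 2 <= enorm (x - y') ^+ 2 + (z - b') ^+ 2.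

Lemma epi_nearest_exists V x z : proper_fun V -> lower_semicontinuous V ->
  exists y b, epi_nearest V x z y b.
Proof.
move=> [Vny [y0 y0V]] lscV.
have [r0 Vr0] : exists r, (V y0 <= r%:E)%E.
  by exists (fine (V y0)); rewrite fineK // fin_numE gt_eqF ?Vny // lt_eqF.
have epi0 : epigraph V !=set0.
  by exists (row_mx y0 r0%:M); rewrite /epigraph /= row_mxKl row_mxKr mxE eqxx.
have [c epic cmin] := nearest_point (row_mx x z%:M) (closed_epigraph lscV) epi0.
exists (lsubmx c), (rsubmx c 0 0); split => // y' b' Vb'.
have := cmin (row_mx y' b'%:M); rewrite /epigraph /= row_mxKl row_mxKr mxE eqxx => /(_ Vb').
rewrite -(@ler_pXn2r _ 2) ?nnegrE ?enorm_ge0 // !sqr_enorm.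
rewrite -{1 2}(hsubmxK c) !opp_row_mx !add_row_mx !dot_row_mx !mxE /= !mulr1n.
by rewrite -!expr2.
Qed.

Lemma prox_normal_epiP V xi y (vy : R) : V y = vy%:E ->
  prox_normal (epigraph V) (row_mx y (fine (V y))%:M) (row_mx xi 0) <->
  exists s d, 0 < d /\ forall y' b', (V y' <= b'%:E)%E ->
    enorm (y' - y) ^+ 2 + (b' - vy) ^+ 2 < d ^+ 2 ->
    dot xi (y' - y) <= s * (enorm (y' - y) ^+ 2 + (b' - vy) ^+ 2).
Proof.
move=> Vy; rewrite Vy /=; set c := row_mx y vy%:M.
have epic : epigraph V c by rewrite /epigraph /= row_mxKl row_mxKr mxE eqxx Vy.
have indc : set_indicator (epigraph V) c = 0%:E.
  by rewrite /set_indicator ifT // inE.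
have nrm y' b' : enorm (row_mx y' b'%:M - c) ^+ 2 =
    enorm (y' - y) ^+ 2 + (b' - vy) ^+ 2.
  by rewrite !sqr_enorm opp_row_mx add_row_mx dot_row_mx !mxE /= !mulr1n expr2.
have dt y' b' : dot (row_mx xi 0) (row_mx y' b'%:M - c) = dot xi (y' - y).
  by rewrite opp_row_mx add_row_mx dot_row_mx mxE mul0r addr0.
have lt_sqr u (d : R) : 0 < d -> (enorm (u : 'rV[R]_(n + 1)) < d) = (enorm u ^+ 2 < d ^+ 2).
  by move=> d0; rewrite ltr_pXn2r // nnegrE ?enorm_ge0 // ltW.
split.
  move=> /(prox_subdiffP _ indc) [s [d [d0 hd]]]; exists s, d; split => // y' b' Vb' yd.
  have := hd (row_mx y' b'%:M); rewrite lt_sqr // nrm dt => /(_ yd).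
  rewrite /set_indicator ifT; first by rewrite lee_fin; lra.
  by rewrite inE /epigraph /= row_mxKl row_mxKr mxE eqxx.
move=> [s [d [d0 hd]]]; apply/(prox_subdiffP _ indc); exists s, d; split => // w.
rewrite -[w]hsubmxK [rsubmx w]mx11_scalar; set y' := lsubmx w; set b' := rsubmx w 0 0.
rewrite lt_sqr // nrm dt => wd; rewrite /set_indicator; case: ifPn => [|_]; last exact: leey.
rewrite inE /epigraph /= row_mxKl row_mxKr mxE eqxx mulr1n => Vb'.
by rewrite lee_fin; have := hd _ _ Vb' wd; lra.
Qed.

Section Nearest.
Variables (V : 'rV[R]_n -> \bar R) (x y : 'rV[R]_n) (z b : R).
Hypotheses (Vny : forall u, (-oo < V u)%E) (near_b : epi_nearest V x z y b).

(** Otherwise raising [b] to [z], which stays in the epigraph, would shorten the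
    distance. *)
Lemma epi_nearest_ge : z <= b.
Proof.
have [Vyb hb] := near_b; rewrite leNgt; apply/negP => bz.
have := hb y z; rewrite subrr expr0n addr0 => /(_ _).
have -> : (V y <= z%:E)%E by apply: le_trans Vyb _; rewrite lee_fin ltW.
move=> /(_ isT); have : 0 < (z - b) ^+ 2 by rewrite exprn_gt0 // subr_gt0.
lra.
Qed.

Let vy := fine (V y).
Let Vy : V y = vy%:E.
Proof.
have [Vyb _] := near_b; rewrite /vy fineK // fin_numE gt_eqF //=.
by rewrite lt_eqF // (le_lt_trans Vyb) // ltry.
Qed.

(** Pushing the epigraph upwards keeps it inside itself, so a horizontal
    projection direction is also normal at the graph point below. *)
Lemma epi_nearest_singular : z = b -> singular_prox_subdiff V y (x - y).
Proof.
move=> zb; have [Vyb hb] := near_b; split; first by rewrite /edom /= Vy ltry.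
apply/(prox_normal_epiP _ Vy); exists 2^-1, 1; split => // y' b' Vb' _.
have bvy : vy <= b by move: Vyb; rewrite Vy lee_fin.
have := hb y' (b' + (b - vy)).
have -> : (V y' <= (b' + (b - vy))%:E)%E.
  by apply: le_trans Vb' _; rewrite lee_fin lerDl subr_ge0.
move=> /(_ isT); rewrite zb.
have -> : b - (b' + (b - vy)) = - (b' - vy) by ring.
have -> : x - y' = (x - y) - (y' - y) by rewrite opprB addrA subrK.
move: (x - y) (y' - y) (b' - vy) => u d e.
rewrite sqrrN subrr expr0n addr0 !sqr_enorm !(dotBl, dotBr) (dotC d u); lra.
Qed.

Lemma epi_nearest_graph : z < b -> V y = b%:E.
Proof.
move=> zb; have [Vyb hb] := near_b; rewrite Vy; congr (_%:E); apply/eqP.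
move: (Vyb); rewrite Vy lee_fin eq_le => -> /=; rewrite leNgt; apply/negP => vb.
have := hb y (Num.max vy z); rewrite Vy lee_fin le_max lexx => /(_ isT).
rewrite lerD2l; have [vz|zv] := leP vy z.
  rewrite subrr expr0n /=.
  have : 0 < (z - b) ^+ 2 by rewrite -sqrrN opprB exprn_gt0 // subr_gt0.
  lra.
nra.
Qed.

(** Below the graph the projection direction is [(l xi, - l)] with
    [l = b - z > 0]. If the proximal inequality failed at some nearby [y'], the
    point of the epigraph above [y'] at the height of the failing quadratic
    minorant would be closer to [(x, z)] than the projection. *)
Lemma epi_nearest_prox : z < b -> prox_subdiff V y ((b - z)^-1 *: (x - y)).
Proof.
move=> zb; have [_ hb] := near_b; have Vyb := epi_nearest_graph zb.
apply/(prox_subdiffP _ Vyb).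
pose l := b - z; have l0 : 0 < l by rewrite subr_gt0.
pose xi := l^-1 *: (x - y); rewrite -/l -/xi.
(* [s] is large enough that [2 l s] beats the error terms [q ^ 2 + |d| ^ 2],
   where [|q| <= (|xi| + 1) |d|] as soon as [s |d| < 1] *)
pose s := ((enorm xi + 1) ^+ 2 + 2) / (2 * l).
have s0 : 0 < s.
  by rewrite divr_gt0 ?mulr_gt0 // ltr_wpDl ?sqr_ge0.
exists s, s^-1; split; first by rewrite invr_gt0.
move=> y' yd; set d := y' - y; rewrite leNgt; apply/negP => Vlt.
pose q := dot xi d - s * enorm d ^+ 2.
have Vq : (V y' <= (b + q)%:E)%E by rewrite /q addrA ltW.
have := hb _ _ Vq.
have -> : x - y' = (x - y) - d by rewrite /d opprB addrA subrK.
have -> : x - y = l *: xi by rewrite /xi scalerA divff ?gt_eqF // scale1r.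
rewrite (sqr_enormD (l *: xi) (- d)) enormN dotNr dotZl.
have dS : s * enorm d < 1 by rewrite mulrC -ltr_pdivlMr // div1r.
have sd0 : 0 <= s * enorm d ^+ 2 by apply: mulr_ge0; [exact: ltW|exact: sqr_ge0].
have qd : `|q| <= (enorm xi + 1) * enorm d.
  apply: le_trans (ler_normB _ _) _; rewrite mulrDl mul1r lerD ?normr_dot_le //.
  rewrite (ger0_norm sd0) expr2 mulrA.
  by rewrite ler_piMl ?enorm_ge0 // ltW.
have q2 : q ^+ 2 <= (enorm xi + 1) ^+ 2 * enorm d ^+ 2.
  rewrite -exprMn -[q ^+ 2]real_normK ?num_real // ler_pXn2r ?nnegrE //.
  by rewrite mulr_ge0 ?enorm_ge0 // addr_ge0 ?enorm_ge0.
have d0 : 0 < enorm d.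
  rewrite lt_def enorm_ge0 andbT; apply/eqP => d0; move: Vlt.
  have -> : y' = y by apply/subr0_eq/enorm_eq0.
  rewrite Vyb lte_fin -/d d0 (enorm_eq0 d0) dot0r; lra.
have sl : 2 * l * s = (enorm xi + 1) ^+ 2 + 2.
  by rewrite /s mulrC divfK // gt_eqF // mulr_gt0.
have -> : z - (b + q) = - l - q by rewrite /l; ring.
have -> : z - b = - l by rewrite /l; ring.
have D0 : 0 < enorm d ^+ 2 by rewrite exprn_gt0.
have lq : l * q = l * dot xi d - l * s * enorm d ^+ 2 by rewrite /q; ring.
have lsD : 2 * (l * s * enorm d ^+ 2) = (enorm xi + 1) ^+ 2 * enorm d ^+ 2 + 2 * enorm d ^+ 2.
  by rewrite -mulrDl -sl; ring.
move=> h; have : 0 <= enorm d ^+ 2 - 2 * (l * dot xi d) + 2 * (l * q) + q ^+ 2.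
  by move: h; rewrite sqrrB sqrrN; lra.
by rewrite lq; lra.
Qed.

End Nearest.
End Epigraph.

(** * From trajectories to the infinitesimal conditions *)

Section Curves.
Variables (R : realType) (n : nat).
Notation lam := (@lebesgue_measure R).

(** A solution matters on nonnegative times only; freezing it before [0] makes
    it continuous on the whole line. *)
Lemma continuous_clamp (x : R -> 'rV[R]_n) :
  {within `[0, +oo[%classic, continuous x} -> continuous (fun t : R => x (Num.max t 0)).
Proof.
move=> xc t; set s := Num.max t 0.
have s0 : 0 <= s by rewrite le_max lexx orbT.
have xs : x @ within `[0, +oo[%classic (nbhs s) --> x s.
  by move/subspace_continuousP : xc; apply; rewrite /= in_itv /= s0.
apply: (@cvg_enormP _ _ _ (nbhs t) _ (fun u : R => x (Num.max u 0)) (x s)).2 => e e0.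
have hw := (@cvg_enormP _ _ _ (within `[0, +oo[%classic (nbhs s))
  (within_filter _ _) x (x s)).1 xs e e0.
have [d /= d0 hd] := (nbhs_ballP s _).1 (hw (nbhs_filter s)).
apply/(nbhs_ballP t); exists d => // u; rewrite /ball /= => tu.
apply: hd; last by rewrite in_itv /= le_max lexx orbT.
rewrite /ball /=; apply: le_lt_trans tu; rewrite /s ler_norml.
by have [] := leP t 0; have [] := leP u 0; have [] := leP 0 (t - u) => h1 h2 h3;
  rewrite ?(ger0_norm h1) ?(ltr0_norm h1); lra.
Qed.

Lemma lower_semicontinuous_comp (W : 'rV[R]_n -> \bar R) (x : R -> 'rV[R]_n) :
  lower_semicontinuous W -> continuous x -> lower_semicontinuous (W \o x).
Proof. by move=> lscW xc t r /lscW[B nB BW]; exists (x @^-1` B); [exact: (xc t B nB)|move=> u; exact: BW]. Qed.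

Lemma measurable_lsc_curve (W : 'rV[R]_n -> \bar R) (x : R -> 'rV[R]_n) (T : R) :
  lower_semicontinuous W -> {within `[0, +oo[%classic, continuous x} ->
  @measurable_fun _ _ (measurableTypeR R) (\bar R) `[0, T]%classic (W \o x).
Proof.
move=> lscW xc; apply: (eq_measurable_fun (W \o (fun t : R => x (Num.max t 0)))).
  by move=> t; rewrite inE /= in_itv /= => /andP[t0 _]; rewrite max_l.
apply: (measurable_funS measurableT) => //.
apply: (@lower_semicontinuous_measurable R (W \o (fun t : R => x (Num.max t 0)))).
exact: (lower_semicontinuous_comp lscW (continuous_clamp xc)).
Qed.

Lemma integral_curve_ge (W : 'rV[R]_n -> \bar R) (x : R -> 'rV[R]_n) (T m : R) :
  lower_semicontinuous W -> {within `[0, +oo[%classic, continuous x} ->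
  0 <= T -> 0 <= m -> (forall t, 0 <= t -> t <= T -> (m%:E <= W (x t))%E) ->
  ((m * T)%:E <= \int[lam]_(t in `[0%R, T]) W (x t))%E.
Proof.
move=> lscW xc T0 m0 hm.
have mI : measurable (`[0, T]%classic : set (measurableTypeR R)) by exact: measurable_itv.
have -> : ((m * T)%:E = \int[lam]_(t in `[0%R, T]) (m%:E))%E.
  rewrite integral_cst // [X in (_ * X)%E]lebesgue_measure_itv /= lte_fin.
  have [T1|T1] := ltP 0 T; first by rewrite oppr0 addr0 EFinM.
  have -> : T = 0 by apply/eqP; rewrite eq_le T1.
  by rewrite mulr0 mule0.
apply: ge0_le_integral => //.
- exact: measurable_lsc_curve.
- by move=> t /=; rewrite in_itv /= => /andP[]; exact: hm.
Qed.

End Curves.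

Section Necessity.
Variables (R : realType) (n : nat) (A F : 'rV[R]_n -> set 'rV[R]_n) (L a : R).
Variables V W : 'rV[R]_n -> \bar R.
Hypotheses (hA : maximal_monotone A) (hF : lipschitz_cusco L F).
Hypotheses (hV : proper_fun V) (lscW : lower_semicontinuous W).
Hypothesis W_ge0 : forall x, (0 <= W x)%E.
Hypothesis lyap : strong_lyapunov_pair A F V W a.

(** The solution with prescribed [v] is Lipschitz near [0], so its right
    difference quotients have a limit point [w]; both conditions at [x0] come
    from dividing the Lyapunov inequality by the time. *)
Lemma lyapunov_velocity x0 v (vx : R) : V x0 = vx%:E -> A x0 !=set0 -> F x0 v ->
  exists2 w, A x0 (v - w) &
    (forall xi m, frechet_subdiff V x0 xi -> 0 <= m ->
      (\forall y \near x0, (m%:E <= W y)%E) -> dot xi w <= - (a * vx) - m) /\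
    (forall xi, singular_prox_subdiff V x0 xi -> dot xi w <= 0).
Proof.
move=> Vx Ax Fv; have [x xsol [M xM quotA]] := exists_solution hA hF Ax Fv.
have [xc _ x00 _] := xsol.
have [G [UG G0]] := ultraFilterLemma (at_right_proper_filter (0 : R)).
have lt_near (d : R) : 0 < d -> \forall h \near G, 0 < h < d.
  move=> d0; apply: G0.
  have h1 : \forall h \near (0 : R)^'+, 0 < h by exact: nbhs_right_gt.
  have h2 : \forall h \near (0 : R)^'+, h < d by exact: nbhs_right_lt.
  by apply: filterS2 h1 h2 => h -> ->.
have [|w _ qw] := @ultra_compact_cvg _ G _ _ _ (fun h => h^-1 *: (x h - x0))
    (@compact_enorm_le _ _ 0 M).
  apply: filterS (lt_near 1 ltr01) => h /andP[h0 h1] /=.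
  rewrite subr0 enormZ gtr0_norm ?invr_gt0 // mulrC ler_pdivrMr //.
  by apply: xM; exact: ltW.
exists w; first exact: (quotA G w (@ultra_proper _ _ UG) G0 qw).
have h_cvg : (h : R) @[h --> G] --> (0 : R).
  by apply: (cvg_trans (G := 0^'+)) => //; apply: cvg_within.
have xh0 : x h @[h --> G] --> x0.
  have : x0 + h *: (h^-1 *: (x h - x0)) @[h --> G] --> x0 + 0 *: w.
    by apply: cvgD; [exact: cvg_cst|exact: cvgZ].
  rewrite scale0r addr0; apply: cvg_trans; apply: near_eq_cvg.
  apply: filterS (lt_near 1 ltr01) => h /andP[h0 _].
  by rewrite scalerA divff ?gt_eqF // scale1r addrC subrK.
have exp_cvg b : expR (b * h) @[h --> G] --> (1 : R).
  rewrite -(@expR0 R) -(mulr0 b).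
  apply: (@cvg_comp _ _ _ (fun h => b * h) (@expR R)); last exact: continuous_expR.
  by apply: cvgM => //; exact: cvg_cst.
have dexp_cvg b : h^-1 * (expR (b * h) - 1) @[h --> G] --> b.
  have dm : is_derive (0 : R) 1 (fun h : R => b * h) b.
    have := @is_deriveZ _ _ _ (@idfun R) b (0 : R) 1 1 (is_derive_id _ _).
    by rewrite /GRing.scale /= mulr1.
  have dE : is_derive (b * 0) 1 (@expR R) 1.
    by have := is_derive_expR (b * 0); rewrite mulr0 expR0.
  have := @is_derive1_comp _ (@expR R) (fun h => b * h) 0 1 b dE dm.
  rewrite mul1r => -[dc dv]; have := derive_right_quotient dc; rewrite dv => dq.
  apply: cvg_trans (cvg_trans (cvg_app _ G0) dq).
  apply: near_eq_cvg; apply: nearW => h /=.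
  by rewrite add0r mulr0 expR0.
(* the Lyapunov inequality at time [h], with [W] replaced by a constant lower
   bound near [x0] *)
have Vh m : 0 <= m -> (\forall y \near x0, (m%:E <= W y)%E) -> \forall h \near G,
    exists2 r, V (x h) = r%:E & expR (a * h) * r + h * m <= vx.
  move=> m0 mW.
  have [d d0 hd] : exists2 d, 0 < d & forall t, 0 <= t -> t <= d -> (m%:E <= W (x t))%E.
    have /nbhs_ballP[e /= e0 he] := mW.
    have M0 : 0 <= M by have := xM 1 ler01 (lexx 1); rewrite mulr1; apply/le_trans/enorm_ge0.
    exists (Num.min 1 (e / (M + 1) / 2)).
      by rewrite lt_min ltr01 !divr_gt0 // ltr_wpDl.
    move=> t t0; rewrite le_min => /andP[t1 te]; apply: he.
    rewrite -ball_normE /= distrC; apply: le_lt_trans (norm_le_enorm _) _.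
    apply: le_lt_trans (xM t t0 t1) _.
    have M1 : 0 < M + 1 by rewrite ltr_wpDl.
    have e1 : 0 < e / (M + 1) by rewrite divr_gt0.
    apply: (@le_lt_trans _ _ ((M + 1) * t)); first by rewrite ler_wpM2r // lerDl.
    by rewrite mulrC -ltr_pdivlMr //; lra.
  apply: filterS (lt_near d d0) => h /andP[h0 hlt].
  have clx : closure (setval_dom A) x0 by apply: subset_closure.
  have := lyap clx xsol (ltW h0); rewrite Vx.
  have := @integral_curve_ge R n W x h m lscW xc (ltW h0) m0.
  move=> /(_ (fun t t0 th => hd t t0 (le_trans th (ltW hlt)))).
  move: (integral _ _ _) => I; have Vny := hV.1 (x h).
  case: I => [I| |] //=; last first.
    by move=> _; case: (V (x h)) Vny => [r| |] //=; rewrite gt0_muley ?lte_fin ?expR_gt0.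
  case: (V (x h)) Vny => [r| |] //= _; last by rewrite gt0_muley ?lte_fin ?expR_gt0.
  by rewrite -EFinM -EFinD !lee_fin => h1 h2; exists r => //; lra.
split=> [xi m|xi [_ sing]].
- move=> fxi m0 mW; apply/ler_addgt0Pr => e e0.
  have e'0 : 0 < e / (enorm w + 1) by rewrite divr_gt0 // ltr_wpDl ?enorm_ge0.
  have [d d0 hd] := (frechet_subdiffP xi Vx).1 fxi _ e'0.
  set e' := e / _ in e'0 hd.
  suff : vx * a + 1 * (dot xi w - e' * enorm w) + m <= 0.
    have : e' * enorm w <= e.
      rewrite /e' mulrAC ler_pdivrMr ?ltr_wpDl ?enorm_ge0 //.
      by rewrite ler_wpM2l ?(ltW e0) // lerDl.
    by rewrite mul1r mulrC; lra.
  apply: (@ler_cvg_to _ G _ _ (fun h => vx * (h^-1 * (expR (a * h) - 1)) +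
     expR (a * h) * (dot xi (h^-1 *: (x h - x0)) - e' * enorm (h^-1 *: (x h - x0))) + m)
     (fun=> 0)); last 1 first.
  + have xd : \forall h \near G, enorm (x h - x0) < d.
      by have /cvg_enormP := xh0; apply.
    apply: filterS3 (Vh m m0 mW) xd (lt_near 1 ltr01) => h [r Vr hr] xd /andP[h0 _].
    have := hd _ xd; rewrite Vr lee_fin => hr'.
    rewrite enormZ dotZr gtr0_norm ?invr_gt0 //.
    rewrite -(ler_pM2l h0) mulr0.
    have -> : h * (vx * (h^-1 * (expR (a * h) - 1)) + expR (a * h) *
       (h^-1 * dot xi (x h - x0) - e' * (h^-1 * enorm (x h - x0))) + m) =
       expR (a * h) * (vx + dot xi (x h - x0) - e' * enorm (x h - x0)) + h * m - vx.
      by field; rewrite gt_eqF.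
    by have := ler_wpM2l (expR_ge0 (a * h)) hr'; lra.
  + apply: cvgD; last exact: cvg_cst.
    apply: cvgD; first by apply: cvgM; [exact: cvg_cst|exact: dexp_cvg].
    apply: cvgM; first exact: exp_cvg.
    apply: cvgB; first by apply: cvg_dot; [exact: cvg_cst|].
    by apply: cvgM; [exact: cvg_cst|exact: cvg_enorm].
  + exact: cvg_cst.
- have [s [d [d0 hd]]] := (prox_normal_epiP xi Vx).1 sing.
  have W0 : \forall y \near x0, (0%:E <= W y)%E by apply: filterE => y; exact: W_ge0.
  (* [vx + c h] bounds [V (x h)] from above, so [(x h, vx + c h)] is a point of
     the epigraph at distance of order [h] from [(x0, vx)] *)
  pose c h := (expR (- a * h) - 1) * vx.
  have cE h : vx + c h = expR (- a * h) * vx by rewrite /c; ring.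
  have c_cvg : c h @[h --> G] --> 0.
    rewrite -[X in _ --> X](mul0r vx) -(subrr 1); apply: cvgM; last exact: cvg_cst.
    by apply: cvgB; [exact: exp_cvg|exact: cvg_cst].
  have en_cvg : enorm (x h - x0) @[h --> G] --> (0 : R).
    by rewrite -(@enorm0 R n) -(subrr x0); apply: cvg_enorm; apply: cvgB => //; exact: cvg_cst.
  suff : dot xi w <= s * (enorm w * 0 + (- a * vx) * 0) by rewrite !mulr0 addr0 mulr0.
  apply: (@ler_cvg_to _ G _ _ (fun h => dot xi (h^-1 *: (x h - x0)))
    (fun h => s * (enorm (h^-1 *: (x h - x0)) * enorm (x h - x0) +
                   (h^-1 * (expR (- a * h) - 1) * vx) * c h))).
  + by apply: cvg_dot => //; exact: cvg_cst.
  + apply: cvgM; first exact: cvg_cst.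
    apply: cvgD; apply: cvgM => //; first exact: cvg_enorm.
    by apply: cvgM; [exact: dexp_cvg|exact: cvg_cst].
  + have sm : \forall h \near G, enorm (x h - x0) ^+ 2 + c h ^+ 2 < d ^+ 2.
      have : enorm (x h - x0) ^+ 2 + c h ^+ 2 @[h --> G] --> ((0 : R) * 0 + 0 * 0).
        by apply: cvgD; [exact: (cvgM en_cvg en_cvg)|exact: (cvgM c_cvg c_cvg)].
      rewrite mulr0 addr0 => /cvgr_lt; apply; by rewrite exprn_gt0.
    apply: filterS3 (Vh 0 (lexx 0) W0) sm (lt_near 1 ltr01) => h [r Vr hr] hs /andP[h0 _].
    rewrite mulr0 addr0 in hr.
    have Vb : (V (x h) <= (vx + c h)%:E)%E.
      rewrite Vr lee_fin cE mulNr expRN.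
      by rewrite mulrC ler_pdivlMr ?expR_gt0 // mulrC.
    have := hd _ _ Vb; rewrite [vx + _]addrC addrK => /(_ hs) hq.
    rewrite dotZr enormZ gtr0_norm ?invr_gt0 //.
    rewrite -(ler_pM2l h0) mulVKf ?gt_eqF //.
    apply: le_trans hq _; rewrite le_eqVlt; apply/orP; left; apply/eqP.
    by rewrite /c; field; rewrite gt_eqF.
Qed.

Lemma lyapunov_infinitesimal x : edom V x -> A x !=set0 ->
  (sup_sup_inf (frechet_subdiff V x) (F x) (A x) <= - (a%:E * V x) - W x)%E /\
  (sup_sup_inf (singular_prox_subdiff V x) (F x) (A x) <= 0)%E.
Proof.
move=> Vlt Ax; have [vx Vx] : exists vx, V x = vx%:E.
  by exists (fine (V x)); rewrite fineK // fin_numE gt_eqF ?hV.1 // lt_eqF.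
split; apply: ge_ereal_sup => _ [xi xiP <-]; apply: ge_ereal_sup => _ [v Fv <-];
  have [w Aw [fr sg]] := lyapunov_velocity Vx Ax Fv.
- apply: (@le_trans _ _ (dot xi w)%:E).
    by apply: ereal_inf_lbound; exists (v - w) => //; rewrite opprB addrC subrK.
  rewrite Vx -EFinM -EFinN.
  have key m : (m%:E < W x)%E -> dot xi w <= - (a * vx) - m.
    move=> mW; have [m0|m0] := leP 0 m.
      apply: fr => //; have [B nB BW] := lscW mW.
      by apply: filterS nB => y /BW /ltW.
    have := fr xi 0 xiP (lexx 0); have W0 : \forall y \near x, (0%:E <= W y)%E.
      by apply: filterE => y; exact: W_ge0.
    by move=> /(_ W0); lra.
  case: (W x) (W_ge0 x) key => [r| |] // _ key.
    rewrite -EFinB lee_fin; apply/ler_addgt0Pr => e e0.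
    by have := key (r - e); rewrite lte_fin => /(_ ltac:(lra)); lra.
  by exfalso; have := key (- (a * vx) - dot xi w + 1); rewrite ltry => /(_ isT); lra.
- apply: (@le_trans _ _ (dot xi w)%:E); last by rewrite lee_fin; exact: sg.
  by apply: ereal_inf_lbound; exists (v - w) => //; rewrite opprB addrC subrK.
Qed.

End Necessity.

(** * Monotonicity of absolutely continuous functions *)

Section Chains.
Variables (R : realType) (U : set R).
Notation lam := (@lebesgue_measure R).

(** Nonoverlapping families are encoded as left-to-right lists, so that one more
    interval can be appended at the right end. *)
Fixpoint chain (lo : R) (s : seq (R * R)) (hi : R) : Prop :=
  if s is p :: s' then
    [/\ lo <= p.1, p.1 <= p.2, (forall z, p.1 <= z <= p.2 -> U z) & chain p.2 s' hi]
  else lo <= hi.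

Lemma chain_le lo s hi : chain lo s hi -> lo <= hi.
Proof.
elim: s lo => //= p s IH lo [h1 h2 _ /IH h3].
exact: le_trans h1 (le_trans h2 h3).
Qed.

Lemma chain_widen lo s hi hi' : hi <= hi' -> chain lo s hi -> chain lo s hi'.
Proof.
move=> hh'; elim: s lo => [|p s IH] lo /=; first by move/le_trans; apply.
by move=> [h1 h2 h3 /IH].
Qed.

Lemma chain_rcons lo s c d : c <= d -> (forall z, c <= z <= d -> U z) ->
  chain lo s c -> chain lo (rcons s (c, d)) d.
Proof.
move=> cd Ucd; elim: s lo => [|p s IH] lo /=; first by move=> loc; split.
by move=> [h1 h2 h3 /IH].
Qed.

Lemma chain_length lo s hi : open U -> chain lo s hi ->
  ((\sum_(p <- s) (p.2 - p.1))%:E <= lam (U `&` `[lo, hi]))%E.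
Proof.
move=> oU; have mU : measurable (U : set (measurableTypeR R)) by exact: open_measurable.
have mI (i : interval R) : measurable ([set` i] : set (measurableTypeR R)).
  exact: measurable_itv.
elim: s lo => [|p s IH] lo /=; first by rewrite big_nil.
move=> [h1 h2 h3 ch]; rewrite big_cons EFinD.
have p2hi := chain_le ch.
apply: (@le_trans _ _ (lam (`[p.1, p.2[%classic `|` (U `&` `[p.2, hi]%classic)))); last first.
  apply: le_measure; rewrite ?inE; [|exact: measurableI|].
    by apply: measurableU => //; exact: measurableI.
  move=> z [|[Uz]] /=; rewrite !in_itv /= => /andP[a1 a2].
    by split; [apply: h3; rewrite a1 ltW|rewrite (le_trans h1 a1) (le_trans (ltW a2))].
  by rewrite a2 (le_trans h1 (le_trans h2 a1)).
rewrite measureU //; last 2 first.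
- exact: measurableI.
- apply/seteqP; split => // z [] /=; rewrite !in_itv /= => /andP[_ a1] [_ /andP[a2 _]].
  by move: (lt_le_trans a1 a2); rewrite ltxx.
apply: leeD; last exact: IH.
rewrite [leRHS]lebesgue_measure_itv /= lte_fin.
have [h4|h4] := ltP p.1 p.2; first by rewrite EFinB.
by rewrite lee_fin subr_le0.
Qed.

Lemma chain_nth lo s hi i : chain lo s hi -> (i < size s)%N ->
  [/\ lo <= (nth (0, 0) s i).1, (nth (0, 0) s i).1 <= (nth (0, 0) s i).2 &
      (nth (0, 0) s i).2 <= hi].
Proof.
elim: s lo i => //= p s IH lo [|i] [h1 h2 _ ch] /=; first by split => //; exact: chain_le ch.
by rewrite ltnS => /(IH _ _ ch)[h3 h4 h5]; split => //; rewrite (le_trans h1) // (le_trans h2).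
Qed.

Lemma chain_ordered lo s hi i j : chain lo s hi -> (i < j < size s)%N ->
  (nth (0, 0) s i).2 <= (nth (0, 0) s j).1.
Proof.
elim: s lo i j => [|p s IH] lo i j; first by rewrite ltn0 andbF.
case: j => [|j]; first by rewrite ltn0.
move=> [_ _ _ ch]; case: i => [|i] /=; rewrite ?ltnS; last by apply: IH ch.
by move=> /(chain_nth ch)[].
Qed.

Lemma chain_variation (phi : R -> R) lo s hi (e d : R) :
  (forall (m : nat) (a b : 'I_m -> R),
    (forall i, [/\ `[lo, hi]%classic (a i), `[lo, hi]%classic (b i) & a i <= b i]) ->
    trivIset setT (fun i => `]a i, b i[%classic) ->
    \sum_(i < m) (b i - a i) < d ->
    \sum_(i < m) `|phi (b i) - phi (a i)| < e) ->
  chain lo s hi -> \sum_(p <- s) (p.2 - p.1) < d ->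
  \sum_(p <- s) `|phi p.2 - phi p.1| < e.
Proof.
move=> ac ch; rewrite (big_nth (0, 0)) [X in _ -> X < _](big_nth (0, 0)) !big_mkord.
apply: ac => [i|].
  have [h1 h2 h3] := chain_nth ch (ltn_ord i).
  by rewrite /= !in_itv /= h1 h2 h3 (le_trans h1 h2) (le_trans h2 h3).
have sep (i j : 'I_(size s)) (z : R) : (i < j)%N ->
    (nth (0, 0) s i).1 < z < (nth (0, 0) s i).2 ->
    (nth (0, 0) s j).1 < z < (nth (0, 0) s j).2 -> False.
  move=> ij /andP[_ z1] /andP[z2 _].
  have := @chain_ordered _ _ _ i j ch; rewrite ij ltn_ord => /(_ isT) h.
  by have := lt_trans (le_lt_trans h z2) z1; rewrite ltxx.
move=> i j _ _ [z [/=]]; rewrite !in_itv /= => zi zj; apply: val_inj.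
by case: (ltngtP i j) => // ij; [case: (sep i j z)|case: (sep j i z)].
Qed.

End Chains.

Section Monotonicity.
Variable R : realType.
Notation lam := (@lebesgue_measure R).

(** The points without the derivative bound are covered by an open set [U] so
    small that absolute continuity bounds the variation of [phi] over it. Moving
    from left to right, [phi] grows at most by [e] per unit of time plus its
    variation over [U]: in [U] the variation pays for the growth, elsewhere the
    derivative bound does. *)
Lemma ac_dini_nonincreasing (phi : R -> R) (s T : R) : s <= T ->
  (forall e, 0 < e -> exists2 d, 0 < d & forall (m : nat) (a b : 'I_m -> R),
    (forall i, [/\ `[s, T]%classic (a i), `[s, T]%classic (b i) & a i <= b i]) ->
    trivIset setT (fun i => `]a i, b i[%classic) ->
    \sum_(i < m) (b i - a i) < d ->
    \sum_(i < m) `|phi (b i) - phi (a i)| < e) ->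
  (\forall t \ae lam, s < (t : R) < T -> forall e, 0 < e -> exists2 d, 0 < d &
     forall h, 0 < h < d -> phi (t + h) <= phi t + e * h) ->
  phi T <= phi s.
Proof.
move=> sT ac [B [mB B0 hB]].
have cont (e : R) : 0 < e -> exists2 d, 0 < d &
    forall t u, s <= t -> t <= u -> u <= T -> u - t < d -> `|phi u - phi t| < e.
  move=> /ac[d d0 hd]; exists d => // t u st tu uT utd.
  have := hd 1%N (fun=> t) (fun=> u); rewrite !big_ord1; apply => //.
  - by move=> _; rewrite /= !in_itv /= st tu uT (le_trans st tu) (le_trans tu uT).
  - by move=> i j _ _ _; rewrite !ord1.
suff main e : 0 < e -> phi T <= phi s + e * (T - s) + e.
  apply/ler_addgt0Pr => e e0.
  have c0 : 0 < T - s + 1 by rewrite ltr_wpDl // subr_ge0.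
  have := main (e / (T - s + 1)); rewrite divr_gt0 // => /(_ isT).
  suff -> : phi s + e / (T - s + 1) * (T - s) + e / (T - s + 1) = phi s + e by [].
  by field; rewrite gt_eqF.
move=> e0; have [d d0 acd] := ac e e0.
pose B' : set (measurableTypeR R) := B `|` [set s].
have mB' : measurable B' by apply: measurableU => //; exact: measurable_set1.
have B'0 : lam B' = 0%E.
  apply/eqP; rewrite eq_le measure_ge0 andbT.
  apply: le_trans (measureU2 _ mB (measurable_set1 s)) _.
  by rewrite [X in (X + _)%E]B0 [X in (_ + X)%E]lebesgue_measure_set1 adde0.
have [|U [oU B'U Ud]] := lebesgue_regularity_outer mB' _ d0.
  by rewrite [ltLHS]B'0 ltry.
have mU : measurable (U : set (measurableTypeR R)) by exact: open_measurable.
have lamU : (lam U < d%:E)%E.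
  apply: le_lt_trans Ud; rewrite -[U in leLHS](setDUK B'U).
  apply: le_trans (measureU2 _ mB' (measurableD mU mB')) _.
  by rewrite [X in (X + _)%E]B'0 add0e.
have chain_bound t sg : t <= T -> chain U s sg t ->
    \sum_(p <- sg) `|phi p.2 - phi p.1| < e.
  move=> tT /(chain_widen tT) ch; apply: (chain_variation acd ch).
  have := chain_length oU ch; rewrite -lte_fin => /le_lt_trans; apply.
  apply: le_lt_trans lamU; apply: le_measure; rewrite ?inE //.
  by apply: measurableI => //; exact: measurable_itv.
pose vset t := [set v | exists2 sg, chain U s sg t & v = \sum_(p <- sg) `|phi p.2 - phi p.1|].
have vsup t : s <= t -> t <= T -> has_sup (vset t).
  move=> st tT; split; first by exists 0, [::]; rewrite ?big_nil.
  by exists e => _ [sg ch ->]; apply/ltW/(chain_bound t).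
pose v t := sup (vset t).
have v_mono t u : s <= t -> t <= u -> u <= T -> v t <= v u.
  move=> st tu uT; apply: ge_sup; first by have [] := vsup t st (le_trans tu uT).
  move=> _ [sg ch ->]; apply: ub_le_sup; first by have [] := vsup u (le_trans st tu) uT.
  by exists sg => //; exact: chain_widen ch.
have v_jump t u : s <= t -> t <= u -> u <= T -> (forall z, t <= z <= u -> U z) ->
    v t + `|phi u - phi t| <= v u.
  move=> st tu uT Utu; rewrite -lerBrDr; apply: ge_sup.
    by have [] := vsup t st (le_trans tu uT).
  move=> _ [sg ch ->]; rewrite lerBrDr; apply: ub_le_sup.
    by have [] := vsup u (le_trans st tu) uT.
  exists (rcons sg (t, u)); first exact: chain_rcons.
  by rewrite -cats1 big_cat /= big_seq1.
have v_ge0 : 0 <= v s.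
  by apply: ub_le_sup; [have [] := vsup s (lexx s) sT|exists [::]; rewrite ?big_nil /=].
pose S := [set t | [/\ s <= t, t <= T & phi t <= phi s + e * (t - s) + v t]].
have Ss : S s by split => //; rewrite subrr mulr0 addr0 lerDl.
have supS : has_sup S by split; [exists s|exists T => t []].
pose c := sup S.
have sc : s <= c by apply: ub_le_sup => //; case: supS.
have cT : c <= T by apply: ge_sup; [exists s|move=> t []].
have Sc : S c.
  split => //; apply/ler_addgt0Pr => r r0.
  have [d' d'0 hd'] := cont r r0.
  have [t [st tT tS] ct] := sup_adherent d'0 supS.
  have tc : t <= c by apply: ub_le_sup; [case: supS|split].
  have /hd' /(_ tc cT) : s <= t by [].
  have -> : c - t < d' by rewrite -/c in ct; lra.
  move=> /(_ isT) /ltW; rewrite ler_norml => /andP[_ h].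
  have := v_mono t c st tc cT.
  have : e * (t - s) <= e * (c - s) by rewrite ler_wpM2l ?(ltW e0) // lerD2r.
  lra.
have grow (u : R) : c < u -> S u -> False.
  by move=> cu /(ub_le_sup supS.2); rewrite leNgt cu.
have [cT'|Tc] := ltP c T; last first.
  have <- : c = T by apply/eqP; rewrite eq_le cT Tc.
  case: Sc => _ _ h; apply: le_trans h _; rewrite lerD2l.
  apply: ge_sup; first by have [] := vsup c sc cT.
  by move=> _ [sg ch ->]; apply/ltW/(chain_bound c).
exfalso; have [_ _ hc] := Sc.
have [Uc|nUc] := pselect (U c).
  have /nbhs_ballP[r /= r0 hr] : nbhs c U by exact: open_nbhs_nbhs.
  pose u := Num.min (c + r / 2) T.
  have cu : c < u by rewrite lt_min cT' andbT ltrDl divr_gt0.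
  have uT : u <= T by rewrite ge_min lexx orbT.
  have ur : u <= c + r / 2 by rewrite ge_min lexx.
  apply: (grow u) => //; split => //; first exact: le_trans sc (ltW cu).
  have Ucu z : c <= z <= u -> U z.
    by move=> /andP[z1 z2]; apply: hr; rewrite /ball /= ltr_norml; lra.
  have hj := v_jump c u sc (ltW cu) uT Ucu.
  have := ler_norm (phi u - phi c).
  have : e * (c - s) <= e * (u - s) by rewrite ler_wpM2l ?(ltW e0) // lerD2r ltW.
  lra.
have cs : s < c.
  rewrite lt_def sc andbT; apply/eqP => cs; apply: nUc; apply: B'U.
  by right; rewrite cs.
have [d' d'0 hd'] : exists2 d', 0 < d' & forall h, 0 < h < d' -> phi (c + h) <= phi c + e * h.
  have : ~ B c by move=> Bc; apply: nUc; apply: B'U; left.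
  have : (~` B) c -> s < c < T -> forall e, 0 < e -> exists2 d, 0 < d &
     forall h, 0 < h < d -> phi (c + h) <= phi c + e * h.
    by move=> nBc; apply: contrapT => h; apply: nBc; apply: hB.
  by move=> h nBc; apply: h => //; rewrite cs cT'.
pose h := Num.min (d' / 2) (T - c).
have h0 : 0 < h by rewrite lt_min divr_gt0 // subr_gt0.
have hd : h <= d' / 2 by rewrite ge_min lexx.
have hT : h <= T - c by rewrite ge_min lexx orbT.
have chT : c + h <= T by lra.
apply: (grow (c + h)); first by rewrite ltrDl.
split => //; first by lra.
have := hd' h; rewrite h0 => /(_ ltac:(lra)).
have := v_mono c (c + h) sc _ chT; rewrite lerDl (ltW h0) => /(_ isT).
by move: hc; rewrite !mulrDr; lra.
Qed.

End Monotonicity.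

(** * Decay of the distance to the epigraph *)

Section Calculus.
Variable R : realType.
Notation lam := (@lebesgue_measure R).

(** The integral starts at [-1], so that the primitive is differentiable at [0]
    on both sides. *)
Lemma primitive_exists (g : R -> R) (K : R) : continuous g ->
  (forall t, 0 <= g t <= K) ->
  exists P : R -> R, [/\ P 0 = 0, forall t : R, 0 <= t -> is_derive t 1 P (g t),
    forall s t, 0 <= s -> s <= t -> 0 <= P t - P s <= K * (t - s) &
    forall t, 0 <= t -> (\int[lam]_(u in `[0%R, t]) (g u)%:E = (P t)%:E)%E].
Proof.
move=> gc gK; pose G t := (\int[lam]_(u in `[-1, t]) g u)%R.
have derG (t : R) : 0 <= t -> is_derive t 1 G (g t).
  move=> t0; have tt : t < t + 1 by rewrite ltrDl.
  have gi : lam.-integrable `[-1, (t + 1)]%classic (EFin \o g).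
    apply: continuous_compact_integrable; first exact: segment_compact.
    exact: continuous_subspaceT.
  have t1 : -1 < t by apply: lt_le_trans t0; rewrite oppr_lt0.
  have [dG vG] := continuous_FTC1_closed tt gi t1 (gc t).
  apply: DeriveDef; [exact: dG|by rewrite -vG derive1E].
have derP (t : R) : 0 <= t -> is_derive t 1 (G - cst (G 0)) (g t).
  move=> /derG dG; have := is_deriveB dG (is_derive_cst (G 0) t 1).
  by rewrite subr0.
have contP (t : R) : 0 <= t -> {for t, continuous (G - cst (G 0))}.
  move=> /derP[dP _]; apply: differentiable_continuous.
  exact/derivable1_diffP.
exists (G - cst (G 0)); split => //.
- by rewrite !fctE subrr.
- move=> s t s0 st.
  have [||c _ ->] := @MVT_segment R (G - cst (G 0)) g s t st.
  + move=> u; rewrite in_itv /= => /andP[su _]; apply: derP.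
    exact: le_trans s0 (ltW su).
  + apply: continuous_in_subspaceT => u; rewrite inE /= in_itv /= => /andP[su _].
    by apply: contP; exact: le_trans su.
  + have /andP[g0 g1] := gK c.
    by rewrite mulr_ge0 ?subr_ge0 //= ler_wpM2r ?subr_ge0.
- move=> t; rewrite le_eqVlt => /predU1P[<-|t0].
    by rewrite set_itv1 integral_set1 !fctE subrr.
  rewrite (@continuous_FTC2 R g (G - cst (G 0)) 0 t t0).
  + by rewrite -EFinB !fctE subrr subr0.
  + exact: continuous_subspaceT.
  + split=> [u|/=|/=].
    * by rewrite in_itv /= => /andP[u0 _]; have [] := derP u (ltW u0).
    * by apply: cvg_at_right_filter; apply: contP.
    * by apply: cvg_at_left_filter; apply: contP; exact: ltW.
  + move=> u; rewrite in_itv /= => /andP[u0 _].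
    by have [_ <-] := derP u (ltW u0); rewrite derive1E.
Qed.

Lemma expR_lipschitz (C s t : R) : 0 <= C -> 0 <= s -> s <= t ->
  0 <= expR (- C * s) - expR (- C * t) <= C * (t - s).
Proof.
move=> C0 s0 st; have Cts : 0 <= C * (t - s) by rewrite mulr_ge0 // subr_ge0.
apply/andP; split; first by rewrite subr_ge0 ler_expR !mulNr lerN2 ler_wpM2l.
have -> : - C * t = - C * s + - (C * (t - s)) by ring.
rewrite expRD -[X in X - _]mulr1 -mulrBr.
have e1 : expR (- C * s) <= 1 by rewrite expR_le1 mulNr oppr_le0 mulr_ge0.
have e2 := expR_ge1Dx (- (C * (t - s))).
have e3 : expR (- (C * (t - s))) <= 1 by rewrite expR_le1 oppr_le0.
apply: (@le_trans _ _ (1 * (1 - expR (- (C * (t - s)))))).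
  by rewrite ler_wpM2r // subr_ge0.
by rewrite mul1r; lra.
Qed.

Lemma expR_gronwall_step (C h : R) : expR (- C * h) * (1 + C * h) <= 1.
Proof.
by rewrite mulNr expRN mulrC ler_pdivrMr ?expR_gt0 // mul1r expR_ge1Dx.
Qed.

End Calculus.

Section Dissipation.
Variables (R : realType) (n : nat) (A F : 'rV[R]_n -> set 'rV[R]_n) (L a k : R).
Variables (V : 'rV[R]_n -> \bar R) (w : 'rV[R]_n -> R).
Hypotheses (mA : monotone_op A) (hF : lipschitz_cusco L F).
Hypothesis Vny : forall x, (-oo < V x)%E.
Hypotheses (a_ge0 : 0 <= a) (k_ge0 : 0 <= k).
Hypothesis w_lip : forall x y, w x - w y <= k * enorm (x - y).
Hypothesis decay_prox : forall y, edom V y ->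
  (sup_sup_inf (prox_subdiff V y) (F y) (A y) <= - (a%:E * V y) - (w y)%:E)%E.
Hypothesis decay_sing : forall y, edom V y ->
  (sup_sup_inf (singular_prox_subdiff V y) (F y) (A y) <= 0)%E.

Lemma sup_sup_inf_ge (D Fx Ax : set 'rV[R]_n) xi v (r : R) : D xi -> Fx v ->
  (forall xs, Ax xs -> r <= dot xi (v - xs)) -> (r%:E <= sup_sup_inf D Fx Ax)%E.
Proof.
move=> Dxi Fv hr; apply: (@le_trans _ _ (ereal_inf [set (dot xi (v - xs))%:E | xs in Ax])).
  by apply: le_ereal_inf_tmp => _ [xs Axs <-]; rewrite lee_fin; exact: hr.
apply: (@le_trans _ _ (ereal_sup [set ereal_inf [set (dot xi (v - xs))%:E
    | xs in Ax] | v in Fx])).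
  by apply: ereal_sup_ubound; exists v.
by apply: ereal_sup_ubound; exists xi.
Qed.

(** Transport to the projection [y]: the velocity [v - xs] at [x] is compared
    with velocities [vy - ys] at [y] by the Lipschitz property of [F] and, for
    every [ys] in [A y], by monotonicity of [A]. *)
Lemma velocity_at_projection x v xs y : F x v -> A x xs -> exists2 vy, F y vy &
  forall ys, A y ys -> dot (x - y) (v - xs) <=
    dot (x - y) (vy - ys) + `|L| * enorm (x - y) ^+ 2.
Proof.
move=> Fv Axs; have [vy Fvy vvy] := lipschitz_cusco_select hF y Fv.
exists vy => // ys Ays; have m := mA Axs Ays.
have : dot (x - y) (v - vy) <= `|L| * enorm (x - y) ^+ 2.
  apply: le_trans (dot_le _ _) _; rewrite expr2 mulrC mulrA.
  by rewrite ler_wpM2r // enorm_ge0.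
by move: m; rewrite dotC !(dotBr _ _ (x - y)); lra.
Qed.

(** Half the derivative of the squared distance to the epigraph is at most a
    multiple of that distance squared: if [z < b], by the first decay condition
    at the projection; if [z = b], by the singular one. *)
Lemma epi_dissipation x v xs z y b (zr : R) : F x v -> A x xs ->
  epi_nearest V x z y b -> - (a * z) - w x <= zr ->
  dot (x - y) (v - xs) + (z - b) * zr <=
  (k + `|L|) * (enorm (x - y) ^+ 2 + (z - b) ^+ 2).
Proof.
move=> Fv Axs nb zr_ge; have [Vyb _] := nb; have zb := epi_nearest_ge nb.
have Vy : edom V y by apply: le_lt_trans Vyb _; exact: ltry.
have [vy Fvy hv] := velocity_at_projection y Fv Axs.
have e0 := enorm_ge0 (x - y); have L0 := normr_ge0 L.
set LL := `|L| in hv L0 *; set E := enorm (x - y) in hv e0 *.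
have kE2 : 0 <= k * E ^+ 2 by rewrite mulr_ge0 // sqr_ge0.
have [bz|zltb] := leP b z.
  have {zb bz} zb : z = b by apply/eqP; rewrite eq_le zb bz.
  have := le_trans (sup_sup_inf_ge (r := dot (x - y) (v - xs) - LL * E ^+ 2)
    (epi_nearest_singular Vny nb zb) Fvy _) (decay_sing Vy).
  rewrite lee_fin zb subrr mul0r expr0n /= addr0 => h.
  suff : dot (x - y) (v - xs) - LL * E ^+ 2 <= 0 by lra.
  by apply: h => ys /hv; lra.
have Vyb' := epi_nearest_graph Vny nb zltb.
have l0 : 0 < b - z by rewrite subr_gt0.
have := le_trans (sup_sup_inf_ge (r := (b - z)^-1 * (dot (x - y) (v - xs) - LL * E ^+ 2))
    (epi_nearest_prox Vny nb zltb) Fvy _) (decay_prox Vy).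
rewrite Vyb' -EFinM -EFinN -EFinB lee_fin => h.
have {}h : dot (x - y) (v - xs) - LL * E ^+ 2 <= (b - z) * (- (a * b) - w y).
  rewrite -ler_pdivrMl //; apply: h => ys /hv hv'.
  by rewrite dotZl ler_wpM2l ?invr_ge0 ?(ltW l0) //; lra.
have lz : (b - z) * (- (a * z) - w x) <= (b - z) * zr by rewrite ler_wpM2l // ltW.
have lw : (b - z) * (w x - w y) <= (b - z) * (k * E) by rewrite ler_wpM2l ?w_lip // ltW.
have kl : 0 <= k * (E - (b - z)) ^+ 2 by rewrite mulr_ge0 // sqr_ge0.
have kl2 : 0 <= k * (b - z) ^+ 2 by rewrite mulr_ge0 // sqr_ge0.
have Ll2 : 0 <= LL * (b - z) ^+ 2 by rewrite mulr_ge0 // sqr_ge0.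
have al : 0 <= a * (b - z) ^+ 2 by rewrite mulr_ge0 // sqr_ge0.
move: (dot (x - y) (v - xs)) (w x) (w y) h lz lw => D wx wy h lz lw; lra.
Qed.

End Dissipation.

(** * Invariance of the epigraph *)

Section SquaredDistance.
Variable R : realType.

(** The squared distance to a fixed point, here [(y, b)], is differentiable from
    the right; later the fixed point is a projection, and the squared distance
    to the epigraph is bounded by it. *)
Lemma sqdist_dini n (X : R -> 'rV[R]_n) (z : R -> R) (t : R)
    (x' y : 'rV[R]_n) (z' b e : R) : 0 < e ->
  h^-1 *: (X (t + h) - X t) @[h --> (0 : R)^'+] --> x' ->
  h^-1 *: (z (t + h) - z t) @[h --> (0 : R)^'+] --> z' ->
  exists2 d, 0 < d & forall h, 0 < h < d ->
    enorm (X (t + h) - y) ^+ 2 + (z (t + h) - b) ^+ 2 <=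
    enorm (X t - y) ^+ 2 + (z t - b) ^+ 2 +
    h * (2 * (dot (X t - y) x' + (z t - b) * z') + e).
Proof.
move=> e0 qX qz.
pose q1 h := h^-1 *: (X (t + h) - X t); pose q2 h := h^-1 * (z (t + h) - z t).
have h_cvg : (h : R) @[h --> 0^'+] --> (0 : R) by apply: cvg_within.
have : 2 * (dot (X t - y) (q1 h) + (z t - b) * q2 h) +
    h * (dot (q1 h) (q1 h) + q2 h ^+ 2) @[h --> (0 : R)^'+] -->
    2 * (dot (X t - y) x' + (z t - b) * z') + 0 * (dot x' x' + z' ^+ 2).
  apply: cvgD; apply: cvgM => //.
  - exact: cvg_cst.
  - by apply: cvgD; [apply: cvg_dot => //; exact: cvg_cst|apply: cvgM => //; exact: cvg_cst].
  - by apply: cvgD; [exact: cvg_dot|exact: (cvgM qz qz)].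
rewrite mul0r addr0 => /cvgr_lt /(_ (2 * (dot (X t - y) x' + (z t - b) * z') + e)).
rewrite ltrDl => /(_ e0) /=; rewrite near_withinE => /nbhs_ballP[d /= d0 hd].
exists d => // h /andP[h0 hlt].
have := hd h; rewrite /ball /= sub0r normrN (gtr0_norm h0) => /(_ hlt h0) /ltW.
rewrite -(ler_pM2l h0) => hq.
have eX : X (t + h) - y = (X t - y) + h *: q1 h.
  rewrite /q1 scalerA divff ?gt_eqF // scale1r.
  by apply/rowP => i; rewrite !mxE; ring.
have ez : z (t + h) - b = (z t - b) + h * q2 h.
  by rewrite /q2; field; rewrite gt_eqF.
rewrite eX ez sqr_enormD dotZr enormZ exprMn real_normK ?num_real // sqr_enorm.
rewrite -(sqr_enorm (q1 h)) in hq *.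
by move: (dot _ _) (q2 h) (enorm (q1 h)) hq => D Q E hq; lra.
Qed.

End SquaredDistance.

Section Invariance.
Variables (R : realType) (n : nat) (A F : 'rV[R]_n -> set 'rV[R]_n) (L a k K : R).
Variables (V : 'rV[R]_n -> \bar R) (w : 'rV[R]_n -> R).
Hypotheses (mA : monotone_op A) (hF : lipschitz_cusco L F).
Hypotheses (hV : proper_fun V) (lscV : lower_semicontinuous V).
Hypotheses (a_ge0 : 0 <= a) (k_ge0 : 0 <= k).
Hypothesis w_bounds : forall x, 0 <= w x <= K.
Hypothesis w_lip : forall x y, w x - w y <= k * enorm (x - y).
Hypothesis decay_prox : forall y, edom V y ->
  (sup_sup_inf (prox_subdiff V y) (F y) (A y) <= - (a%:E * V y) - (w y)%:E)%E.
Hypothesis decay_sing : forall y, edom V y ->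
  (sup_sup_inf (singular_prox_subdiff V y) (F y) (A y) <= 0)%E.

(** With [z' = - a z - e^(- a t) w (x)] the pair [(x, z)] starts on the epigraph
    of [V]; its squared distance [eta] to the epigraph satisfies
    [eta' <= C eta] almost everywhere, hence vanishes. *)
Lemma epigraph_invariant x0 (v0 : R) (x : R -> 'rV[R]_n) (T : R) :
  V x0 = v0%:E -> is_solution A F x0 x -> 0 <= T ->
  exists2 I : R,
    (\int[@lebesgue_measure R]_(t in `[0%R, T]) (w (x t))%:E = I%:E)%E &
    (V (x T) <= (expR (- a * T) * (v0 - I))%:E)%E.
Proof.
move=> Vx0 [xc xac x00 xder] T0.
pose X (t : R) := x (Num.max t 0).
have XE t : 0 <= t -> X t = x t by move=> t0; rewrite /X max_l.
have Xc : continuous X by exact: continuous_clamp.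
have X0 : X 0 = x0 by rewrite XE.
have gc : continuous (w \o X).
  move=> t; apply/cvgrPdist_lt => e e0.
  have e'0 : 0 < e / (k + 1) by rewrite divr_gt0 // ltr_wpDl.
  have near_t := (@cvg_enormP _ _ _ (nbhs t) (nbhs_filter t) X (X t)).1 (Xc t) _ e'0.
  apply: filterS near_t => u; rewrite ltr_pdivlMr ?ltr_wpDl // => uu'.
  apply: (@le_lt_trans _ _ (k * enorm (X u - X t))).
    rewrite ler_norml /=; have := w_lip (X t) (X u); have := w_lip (X u) (X t).
    by rewrite (enormB (X t)); lra.
  by apply: le_lt_trans uu'; rewrite mulrC ler_wpM2l ?enorm_ge0 // lerDl.
have [P [P0 dP Plip Pint]] := primitive_exists gc (fun t => w_bounds (X t)).
exists (P T).
  rewrite -Pint //; apply: eq_integral => t; rewrite inE /= in_itv /= => /andP[t0 _].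
  by rewrite XE.
have K0 : 0 <= K by have /andP[h1 h2] := w_bounds x0; exact: le_trans h2.
pose z t := expR (- a * t) * (v0 - P t).
have z0 : z 0 = v0 by rewrite /z P0 mulr0 expR0 mul1r subr0.
have [p pP] : {p & forall t, epi_nearest V (X t) (z t) (p t).1 (p t).2}.
  apply: (@choice _ _ (fun t (p : 'rV[R]_n * R) => epi_nearest V (X t) (z t) p.1 p.2)) => t.
  by have [y [b yb]] := epi_nearest_exists (X t) (z t) hV lscV; exists (y, b).
pose eta t := enorm (X t - (p t).1) ^+ 2 + (z t - (p t).2) ^+ 2.
have eta_ge0 t : 0 <= eta t by rewrite addr_ge0 // sqr_ge0.
have eta_le t u : eta u <= enorm (X u - (p t).1) ^+ 2 + (z u - (p t).2) ^+ 2.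
  by apply: (pP u).2; have [] := pP t.
have eta_le0 u : eta u <= enorm (X u - x0) ^+ 2 + (z u - v0) ^+ 2.
  by apply: (pP u).2; rewrite Vx0.
have eta00 : eta 0 = 0.
  apply/eqP; rewrite eq_le eta_ge0 andbT; apply: le_trans (eta_le0 0) _.
  by rewrite X0 z0 !subrr enorm0 expr0n addr0.
suff eta_T : eta T <= 0.
  have [VpT _] := pP T.
  have [h1 h2] := (sqr_ge0 (enorm (X T - (p T).1)), sqr_ge0 (z T - (p T).2)).
  have XT : X T = (p T).1.
    apply/subr0_eq/enorm_eq0/eqP; rewrite -sqrf_eq0 eq_le h1 andbT.
    by move: eta_T; rewrite /eta; lra.
  have zT : z T = (p T).2.
    apply/subr0_eq/eqP; rewrite -sqrf_eq0 eq_le h2 andbT.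
    by move: eta_T; rewrite /eta; lra.
  by rewrite -XE // XT; apply: le_trans VpT _; rewrite -zT.
move: T0; rewrite le_eqVlt => /predU1P[<-|T0]; first by rewrite eta00.
pose Q1 := a * (`|v0| + K * T) + K.
have Q10 : 0 <= Q1.
  by rewrite addr_ge0 // mulr_ge0 // addr_ge0 // mulr_ge0 // ltW.
have z_lip t u : 0 <= t -> t <= u -> u <= T -> `|z u - z t| <= Q1 * (u - t).
  move=> t0 tu uT.
  have -> : z u - z t = - ((expR (- a * t) - expR (- a * u)) * (v0 - P u)
      + expR (- a * t) * (P u - P t)) by rewrite /z; ring.
  rewrite normrN (le_trans (ler_normD _ _)) // !normrM /Q1 mulrDl lerD //.
    have /andP[e1 e2] := expR_lipschitz a_ge0 t0 tu.
    rewrite (ger0_norm e1) -mulrA (mulrC (`|v0| + _)) mulrA ler_pM //.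
    have := Plip 0 u (lexx 0) (le_trans t0 tu); rewrite P0 !subr0 => /andP[Pu0 PuK].
    apply: le_trans (ler_normB _ _) _; rewrite lerD2l ger0_norm //.
    by apply: le_trans PuK _; rewrite ler_wpM2l.
  have /andP[p0 pK] := Plip t u t0 tu; rewrite (ger0_norm p0) ger0_norm ?expR_ge0 //.
  rewrite -[leRHS]mul1r ler_pM ?expR_ge0 //.
  by rewrite expR_le1 mulNr oppr_le0 mulr_ge0.
have [D D0 hD] : exists2 D, 0 < D & forall t, 0 <= t -> t <= T ->
    enorm (X t - x0) <= D /\ `|z t - v0| <= D.
  have cX : {within `[0, T]%classic, continuous (fun t => enorm (X t - x0))}.
    apply: continuous_subspaceT => t; apply: (@cvg_enorm _ _ _ (nbhs t) _ (fun t => X t - x0)).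
    by apply: cvgB; [exact: Xc|exact: cvg_cst].
  have [t1 _ ht1] := EVT_max (ltW T0) cX.
  exists (enorm (X t1 - x0) + Q1 * T + 1).
    by rewrite ltr_wpDl // addr_ge0 ?enorm_ge0 // mulr_ge0 // ltW.
  have q0 : 0 <= Q1 * T by rewrite mulr_ge0 // ltW.
  move=> t t0 tT; split.
    have := ht1 t; rewrite in_itv /= t0 tT => /(_ isT) h; apply: le_trans h _.
    by rewrite -addrA lerDl addr_ge0.
  have := z_lip 0 t (lexx 0) t0 tT; rewrite z0 subr0 => h; apply: le_trans h _.
  have : Q1 * t <= Q1 * T by rewrite ler_wpM2l.
  by have := enorm_ge0 (X t1 - x0); lra.
have eta_bound t : 0 <= t -> t <= T -> eta t <= 2 * D ^+ 2.
  move=> t0 tT; have [h1 h2] := hD t t0 tT; apply: le_trans (eta_le0 t) _.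
  have -> : 2 * D ^+ 2 = D ^+ 2 + D ^+ 2 by ring.
  apply: lerD; first by rewrite ler_pXn2r ?nnegrE ?enorm_ge0 // ltW.
  by rewrite -[leLHS]real_normK ?num_real // ler_pXn2r ?nnegrE // ltW.
have part_bound t : 0 <= t -> t <= T ->
    enorm (X t - (p t).1) <= 2 * D /\ `|z t - (p t).2| <= 2 * D.
  move=> t0 tT; have := eta_bound t t0 tT; rewrite /eta => h.
  have D2 : 0 <= 2 * D by rewrite mulr_ge0 // ltW.
  have h1 := sqr_ge0 (enorm (X t - (p t).1)); have h2 := sqr_ge0 (z t - (p t).2).
  have h3 : 2 * D ^+ 2 <= (2 * D) ^+ 2 by rewrite exprMn; have := sqr_ge0 D; lra.
  split; rewrite -(@ler_pXn2r _ 2) ?nnegrE ?enorm_ge0 //; first by lra.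
  by rewrite real_normK ?num_real //; lra.
have eta_lip t u : 0 <= t -> t <= T -> 0 <= u -> u <= T ->
    eta u - eta t <= 6 * D * (enorm (X u - X t) + `|z u - z t|).
  move=> t0 tT u0 uT; have [b1 b2] := part_bound t t0 tT.
  have [c1 c2] := hD t t0 tT; have [d1 d2] := hD u u0 uT.
  rewrite lerBlDl; apply: le_trans (eta_le t u) _; rewrite /eta.
  have -> : X u - (p t).1 = (X t - (p t).1) + (X u - X t).
    by apply/rowP => i; rewrite !mxE; ring.
  have -> : z u - (p t).2 = (z t - (p t).2) + (z u - z t) by ring.
  have e1 : enorm (X u - X t) <= 2 * D.
    by have := enorm_triangle x0 (X u) (X t); rewrite (enormB x0); lra.
  have e2 : `|z u - z t| <= 2 * D.
    have -> : z u - z t = (z u - v0) - (z t - v0) by ring.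
    by apply: le_trans (ler_normB _ _) _; lra.
  have f1 : dot (X t - (p t).1) (X u - X t) <= 2 * D * enorm (X u - X t).
    by apply: le_trans (dot_le _ _) _; rewrite ler_wpM2r ?enorm_ge0.
  have f2 : (z t - (p t).2) * (z u - z t) <= 2 * D * `|z u - z t|.
    by apply: le_trans (ler_norm _) _; rewrite normrM ler_wpM2r.
  have f3 : enorm (X u - X t) ^+ 2 <= 2 * D * enorm (X u - X t).
    by rewrite expr2 ler_wpM2r ?enorm_ge0.
  have f4 : (z u - z t) ^+ 2 <= 2 * D * `|z u - z t|.
    by rewrite -real_normK ?num_real // expr2 ler_wpM2r.
  by rewrite sqr_enormD sqrrD; lra.
pose C := 2 * (k + `|L|); have C0 : 0 <= C by rewrite mulr_ge0 // addr_ge0.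
pose phi t := expR (- C * t) * eta t.
pose Q := 6 * D * (1 + Q1) + 2 * D ^+ 2 * C.
have Q0 : 0 <= Q.
  have D0' := ltW D0.
  by rewrite addr_ge0 // mulr_ge0 ?mulr_ge0 ?sqr_ge0 // addr_ge0.
have phi_lip t u : 0 <= t -> t <= u -> u <= T ->
    `|phi u - phi t| <= Q * (enorm (X u - X t) + (u - t)).
  move=> t0 tu uT; have u0 := le_trans t0 tu; have tT := le_trans tu uT.
  have -> : phi u - phi t = expR (- C * u) * (eta u - eta t)
      - (expR (- C * t) - expR (- C * u)) * eta t by rewrite /phi; ring.
  apply: le_trans (ler_normB _ _) _; rewrite !normrM.
  have /andP[e1 e2] := expR_lipschitz C0 t0 tu.
  rewrite (ger0_norm e1) (ger0_norm (eta_ge0 t)) (ger0_norm (expR_ge0 _)).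
  have h1 : expR (- C * u) * `|eta u - eta t| <=
      6 * D * (enorm (X u - X t) + Q1 * (u - t)).
    have h2 : `|eta u - eta t| <= 6 * D * (enorm (X u - X t) + Q1 * (u - t)).
      have D6 : 0 <= 6 * D by rewrite mulr_ge0 // ltW.
      apply: (@le_trans _ _ (6 * D * (enorm (X u - X t) + `|z u - z t|))).
        have := eta_lip t u t0 tT u0 uT; have := eta_lip u t u0 uT t0 tT.
        by rewrite (enormB (X t)) (distrC (z t)) ler_norml; lra.
      by rewrite ler_wpM2l // lerD2l z_lip.
    apply: le_trans h2; rewrite -[leRHS]mul1r ler_wpM2r //.
    by rewrite expR_le1 mulNr oppr_le0 mulr_ge0.
  have h2 : (expR (- C * t) - expR (- C * u)) * eta t <= C * (u - t) * (2 * D ^+ 2).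
    by apply: ler_pM => //; exact: eta_bound.
  have h3 : 0 <= 6 * D * Q1 * enorm (X u - X t) + 2 * D ^+ 2 * C * enorm (X u - X t)
      + 6 * D * (u - t).
    have s3 : 0 <= 6 * D by rewrite mulr_ge0 // ltW.
    have s1 : 0 <= 6 * D * Q1 by rewrite mulr_ge0.
    have s2 : 0 <= 2 * D ^+ 2 * C by rewrite mulr_ge0 // mulr_ge0 // sqr_ge0.
    by rewrite !addr_ge0 ?(mulr_ge0 s1) ?(mulr_ge0 s2) ?(mulr_ge0 s3) ?enorm_ge0 ?subr_ge0.
  by rewrite /Q; lra.
have phi_mono s : 0 < s -> s <= T -> phi T <= phi s.
  move=> s0 sT; apply: ac_dini_nonincreasing => //.
  - move=> e e0; pose e' := e / (2 * (Q + 1)).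
    have Q2 : 0 < 2 * (Q + 1) by rewrite mulr_gt0 // ltr_wpDl.
    have e'0 : 0 < e' by rewrite divr_gt0.
    have [|d d0 hd] := xac `[s, T]%classic (@segment_compact _ s T) _ e' e'0.
      by move=> t /=; rewrite !in_itv /= => /andP[st _]; rewrite andbT (lt_le_trans s0).
    exists (Num.min d e'); first by rewrite lt_min d0.
    move=> m al be hab tri; rewrite lt_min => /andP[sd se].
    have xsum := hd m al be hab tri sd.
    have : \sum_(i < m) `|phi (be i) - phi (al i)| <=
        Q * (\sum_(i < m) enorm (x (be i) - x (al i)) + \sum_(i < m) (be i - al i)).
      rewrite -big_split mulr_sumr; apply: ler_sum => i _ /=.
      have [] := hab i; rewrite /= !in_itv /= => /andP[sa _] /andP[sb bT] ab.
      by rewrite -!XE ?(le_trans (ltW s0)) // phi_lip // (le_trans (ltW s0)).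
    move=> /le_lt_trans; apply.
    have -> : e = (Q + 1) * (e' + e') by rewrite /e'; field; rewrite gt_eqF // ltr_wpDl.
    apply: (@le_lt_trans _ _ ((Q + 1) * (\sum_(i < m) enorm (x (be i) - x (al i)) +
        \sum_(i < m) (be i - al i)))).
      rewrite ler_wpM2r ?lerDl // addr_ge0 // sumr_ge0 // => i _; first exact: enorm_ge0.
      by have [_ _] := hab i; rewrite subr_ge0.
    have Q1' : 0 < Q + 1 by rewrite ltr_wpDl.
    by rewrite (ltr_pM2l Q1'); exact: (ltrD xsum se).
  - move: xder; apply: filterS; first exact: (ae_filter_ringOfSetsType lebesgue_measure).
    move=> t ht /andP[st tT] e e0.
    have t0 := lt_trans s0 st.
    have [dx [v Fv [xs Axs xsE]]] := ht (ltW t0).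
    have qX : h^-1 *: (X (t + h) - X t) @[h --> (0 : R)^'+] --> 'D_1 x t.
      have := derive_right_quotient dx; apply: cvg_trans; apply: near_eq_cvg.
      have h0 : \forall h \near (0 : R)^'+, 0 < h by exact: nbhs_right_gt.
      by apply: filterS h0 => h h0; rewrite !XE ?addr_ge0 // ltW.
    pose z' := - a * z t - expR (- a * t) * w (X t).
    have dz : is_derive t 1 z z'.
      have dm : is_derive t 1 (fun u : R => - a * u) (- a).
        have := @is_deriveZ _ _ _ (@idfun R) (- a) t 1 1 (is_derive_id _ _).
        by rewrite /GRing.scale /= mulr1.
      have dE := @is_derive1_comp _ (@expR R) (fun u => - a * u) t _ _ (is_derive_expR _) dm.
      have dB := is_deriveB (is_derive_cst v0 t 1) (dP t (ltW t0)).
      have zE : z = (@expR R \o (fun u => - a * u)) * (cst v0 - P) by apply/funext.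
      have := is_deriveM dE dB; rewrite -zE => dM; apply: (is_derive_eq dM).
      by rewrite /GRing.scale /= /z' /z !fctE /=; ring.
    have qz : h^-1 *: (z (t + h) - z t) @[h --> (0 : R)^'+] --> z'.
      by have [dz' <-] := dz; exact: derive_right_quotient.
    have [d d0 hd] := @sqdist_dini _ _ X z t _ (p t).1 _ (p t).2 e e0 qX qz.
    exists d => // h hh; have /andP[h0 _] := hh.
    have ze : - (a * z t) - w (X t) <= z'.
      rewrite /z' mulNr lerD2l lerN2 -[leRHS]mul1r ler_wpM2r //.
        by have /andP[] := w_bounds (X t).
      by rewrite expR_le1 mulNr oppr_le0 mulr_ge0 // ltW.
    have FX : F (X t) v by rewrite XE // ltW.
    have AX : A (X t) xs by rewrite XE // ltW.
    have := epi_dissipation mA hF hV.1 a_ge0 k_ge0 w_lip decay_prox decay_sing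
      FX AX (pP t) ze.
    rewrite xsE -/(eta t) => diss.
    have eta_h : eta (t + h) <= eta t * (1 + C * h) + h * e.
      apply: le_trans (eta_le t (t + h)) _; apply: le_trans (hd h hh) _.
      rewrite -/(eta t).
      have : h * (2 * (dot (X t - (p t).1) ('D_1 x t) + (z t - (p t).2) * z')) <=
          h * (2 * ((k + `|L|) * eta t)).
        by rewrite ler_wpM2l ?(ltW h0) // ler_wpM2l.
      by rewrite /C; lra.
    rewrite /phi.
    have -> : - C * (t + h) = - C * t + - C * h by ring.
    rewrite expRD -mulrA.
    have E1 := expR_ge0 (- C * t); have E2 := expR_ge0 (- C * h).
    have g1 : expR (- C * h) * eta (t + h) <= eta t + h * e.
      apply: le_trans (ler_wpM2l E2 eta_h) _; rewrite mulrDr lerD //.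
        rewrite mulrCA -[leRHS]mulr1 ler_wpM2l //; exact: expR_gronwall_step.
      rewrite -[leRHS]mul1r ler_wpM2r ?mulr_ge0 ?(ltW h0) ?(ltW e0) //.
      by rewrite expR_le1 mulNr oppr_le0 mulr_ge0 // ltW.
    apply: le_trans (ler_wpM2l E1 g1) _; rewrite mulrDr lerD2l (mulrC e).
    rewrite -[leRHS]mul1r ler_wpM2r ?mulr_ge0 ?(ltW h0) ?(ltW e0) //.
    by rewrite expR_le1 mulNr oppr_le0 mulr_ge0 // ltW.
(* let [s] tend to [0] *)
have phiT : phi T <= 0.
  apply/ler_addgt0Pr => e e0; rewrite add0r.
  have e'0 : 0 < e / (Q + 1) / 2 by rewrite !divr_gt0 // ltr_wpDl.
  have X_near := (@cvg_enormP _ _ _ (nbhs (0 : R)) (nbhs_filter (0 : R)) X (X 0)).1 (Xc 0) _ e'0.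
  have [d /= d0 hd] := (nbhs_ballP (0 : R) _).1 X_near.
  pose s := Num.min (Num.min (d / 2) T) (e / (Q + 1) / 2).
  have s0 : 0 < s by rewrite !lt_min divr_gt0 // T0.
  have sT : s <= T by rewrite !ge_min lexx !orbT.
  have sd : s <= d / 2 by rewrite !ge_min lexx.
  have se : s <= e / (Q + 1) / 2 by rewrite ge_min lexx orbT.
  apply: le_trans (phi_mono s s0 sT) _.
  have := phi_lip 0 s (lexx 0) (ltW s0) sT.
  have -> : phi 0 = 0 by rewrite /phi eta00 mulr0.
  rewrite !subr0 => /(le_trans (ler_norm _)) h; apply: le_trans h _.
  have : enorm (X s - X 0) < e / (Q + 1) / 2.
    by apply: hd; rewrite /ball /= sub0r normrN (gtr0_norm s0); lra.
  move=> /ltW Xs; have Q1' : 0 < Q + 1 by rewrite ltr_wpDl.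
  apply: (@le_trans _ _ ((Q + 1) * (e / (Q + 1)))); last by rewrite mulrC divfK ?gt_eqF.
  apply: ler_pM => //; first by rewrite addr_ge0 ?enorm_ge0 // ltW.
    by rewrite lerDl.
  by lra.
by move: phiT; rewrite /phi pmulr_rle0 ?expR_gt0.
Qed.

End Invariance.

(** * From the infinitesimal conditions to trajectories *)

Section LipschitzRegularization.
Variables (R : realType) (n : nat) (W : 'rV[R]_n -> \bar R).
Hypotheses (W_ge0 : forall x, (0 <= W x)%E) (lscW : lower_semicontinuous W).

Let cut (k : nat) u : R := fine (Order.min (W u) k%:R%:E).

Let cutE k u : ((cut k u)%:E = Order.min (W u) k%:R%:E)%E.
Proof.
rewrite /cut fineK //; have := W_ge0 u; case: (W u) => [r| |] //= _.
by rewrite -EFin_min.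
Qed.

(** The largest [k]-Lipschitz minorant of [min W k]. *)
Definition lip_reg (k : nat) (y : 'rV[R]_n) : R :=
  inf (range (fun u => cut k u + k%:R * enorm (y - u))).

Let cut_bounds k u : 0 <= cut k u <= k%:R.
Proof.
by rewrite -!lee_fin cutE ge_min lexx orbT andbT le_min W_ge0 lee_fin ler0n.
Qed.

Let lip_reg_le k y u : lip_reg k y <= cut k u + k%:R * enorm (y - u).
Proof.
apply: ge_inf; last by exists u.
exists 0 => _ [u' _ <-]; have /andP[c0 _] := cut_bounds k u'.
by rewrite addr_ge0 // mulr_ge0 // enorm_ge0.
Qed.

Let le_lip_reg k y r : (forall u, r <= cut k u + k%:R * enorm (y - u)) -> r <= lip_reg k y.
Proof.
move=> h; apply: lb_le_inf; first by exists (cut k 0 + k%:R * enorm (y - 0)), 0.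
by move=> _ [u _ <-].
Qed.

Lemma lip_reg_bounds k y : 0 <= lip_reg k y <= k%:R.
Proof.
apply/andP; split.
  apply: le_lip_reg => u; have /andP[c0 _] := cut_bounds k u.
  by rewrite addr_ge0 // mulr_ge0 // enorm_ge0.
apply: le_trans (lip_reg_le k y y) _; rewrite subrr enorm0 mulr0 addr0.
by have /andP[] := cut_bounds k y.
Qed.

Lemma lip_reg_lipschitz k x y : lip_reg k x - lip_reg k y <= k%:R * enorm (x - y).
Proof.
rewrite lerBlDr -lerBlDl; apply: le_lip_reg => u; rewrite lerBlDl.
apply: le_trans (lip_reg_le k x u) _; rewrite addrCA lerD2l -mulrDr ler_wpM2l //.
exact: enorm_triangle.
Qed.

Lemma lip_reg_le_fun k y : ((lip_reg k y)%:E <= W y)%E.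
Proof.
apply: (@le_trans _ _ (cut k y)%:E); last by rewrite cutE ge_min lexx.
by rewrite lee_fin; have := lip_reg_le k y y; rewrite subrr enorm0 mulr0 addr0.
Qed.

Lemma lip_reg_nondecreasing y k m : (k <= m)%N -> lip_reg k y <= lip_reg m y.
Proof.
move=> km; apply: le_lip_reg => u; apply: le_trans (lip_reg_le k y u) _.
have km' : k%:R <= m%:R :> R by rewrite ler_nat.
apply: lerD; last by rewrite ler_wpM2r // enorm_ge0.
by rewrite -lee_fin !cutE le_min !ge_min lexx /= lee_fin km' orbT.
Qed.

(** Near [y] the function [W] exceeds a given [r < W y], and away from [y] the
    penalty [k |y - u|] exceeds [r] for large [k]. *)
Lemma lip_reg_cvg y : (lip_reg k y)%:E @[k --> \oo] --> W y.
Proof.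
have nd : nondecreasing_seq (fun k => (lip_reg k y)%:E).
  by move=> k m km; rewrite lee_fin lip_reg_nondecreasing.
suff <- : ereal_sup (range (fun k => (lip_reg k y)%:E)) = W y.
  exact: ereal_nondecreasing_cvgn.
apply/eqP; rewrite eq_le; apply/andP; split.
  by apply: ge_ereal_sup => _ [k _ <-]; exact: lip_reg_le_fun.
rewrite leNgt; apply/negP => lt_sup.
have [r /andP[sr rW]] : exists r : R,
    (ereal_sup (range (fun k => (lip_reg k y)%:E)) < r%:E < W y)%E.
  have s0 : (0 <= ereal_sup (range (fun k => (lip_reg k y)%:E)))%E.
    apply: (@le_trans _ _ (lip_reg 0 y)%:E); last by apply: ereal_sup_ubound; exists 0%N.
    by rewrite lee_fin; have /andP[] := lip_reg_bounds 0 y.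
  case: (ereal_sup _) s0 lt_sup => [s| |] // _; case: (W y) => [t| |] //.
    by rewrite lte_fin => st; exists ((s + t) / 2); rewrite !lte_fin; apply/andP; split; lra.
  by move=> _; exists (s + 1); rewrite lte_fin ltrDl ltr01 ltry.
have [B nB BW] := lscW rW.
have /nbhs_ballP[d /= d0 dB] := nB.
pose k := (Num.bound (`|r| + `|r| / d)).
have kr : `|r| + `|r| / d < k%:R.
  by apply: archi_boundP; rewrite addr_ge0 // divr_ge0 // ltW.
have rd : 0 <= `|r| / d by rewrite divr_ge0 // ltW.
have : (r%:E <= (lip_reg k y)%:E)%E.
  rewrite lee_fin; apply: le_lip_reg => u; have /andP[c0 _] := cut_bounds k u.
  have [ud|ud] := ltP (enorm (y - u)) d.
    have Wu : (r%:E < W u)%E.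
      by apply: BW; apply: dB; rewrite -ball_normE /=; apply: le_lt_trans (norm_le_enorm _) ud.
    have rk : r <= k%:R by apply: le_trans (ler_norm r) (le_trans _ (ltW kr)); rewrite lerDl.
    have rcut : r <= cut k u by rewrite -lee_fin cutE le_min (ltW Wu) lee_fin.
    by apply: le_trans rcut _; rewrite lerDl mulr_ge0 // enorm_ge0.
  apply: le_trans (ler_norm r) _.
  apply: (@le_trans _ _ (k%:R * d)); last first.
    by apply: (@le_trans _ _ (k%:R * enorm (y - u))); rewrite ?ler_wpM2l // lerDr.
  by rewrite -ler_pdivrMr //; apply: le_trans (ltW kr); rewrite lerDr.
move=> /(lt_le_trans sr); apply/negP; rewrite -leNgt.
by apply: ereal_sup_ubound; exists k.
Qed.

Lemma lip_reg_lsc k : lower_semicontinuous (fun y => (lip_reg k y)%:E).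
Proof.
move=> y r; rewrite lte_fin => ry.
have c0 : 0 < k%:R * n%:R + 1 :> R by rewrite ltr_wpDl // mulr_ge0.
exists (ball y ((lip_reg k y - r) / (k%:R * n%:R + 1))).
  by apply: nbhsx_ballx; rewrite divr_gt0 // subr_gt0.
move=> u; rewrite -ball_normE /= (ltr_pdivlMr _ _ c0) => yu.
rewrite lte_fin; have h1 := lip_reg_lipschitz k y u.
have h2 : k%:R * enorm (y - u) <= k%:R * (n%:R * `|y - u|).
  by rewrite ler_wpM2l // enorm_le_norm.
by have := normr_ge0 (y - u); rewrite mulrDr mulr1 in yu; lra.
Qed.

End LipschitzRegularization.

Section Sufficiency.
Variables (R : realType) (n : nat) (A F : 'rV[R]_n -> set 'rV[R]_n) (L a : R).
Variables V W : 'rV[R]_n -> \bar R.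
Hypotheses (mA : monotone_op A) (hF : lipschitz_cusco L F).
Hypotheses (hV : proper_fun V) (lscV : lower_semicontinuous V).
Hypotheses (W_ge0 : forall x, (0 <= W x)%E) (lscW : lower_semicontinuous W).
Hypothesis a_ge0 : 0 <= a.
Hypothesis decay_prox : forall y, edom V y ->
  (sup_sup_inf (prox_subdiff V y) (F y) (A y) <= - (a%:E * V y) - W y)%E.
Hypothesis decay_sing : forall y, edom V y ->
  (sup_sup_inf (singular_prox_subdiff V y) (F y) (A y) <= 0)%E.

Lemma infinitesimal_lyapunov : strong_lyapunov_pair A F V W a.
Proof.
move=> x0 _ x sol T T0.
have [->|Vx0] := eqVneq (V x0) +oo%E; first exact: leey.
have {Vx0} [v0 Vx0] : exists v0, V x0 = v0%:E.
  by exists (fine (V x0)); rewrite fineK // fin_numE Vx0 gt_eqF ?hV.1.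
have decay_reg k y : edom V y ->
    (sup_sup_inf (prox_subdiff V y) (F y) (A y) <= - (a%:E * V y) - (lip_reg W k y)%:E)%E.
  move=> /decay_prox /le_trans; apply; apply: leeB => //; exact: lip_reg_le_fun.
have inv k := epigraph_invariant mA hF hV lscV a_ge0 (ler0n R k) (lip_reg_bounds W_ge0 k)
  (lip_reg_lipschitz W_ge0 k) (decay_reg k) decay_sing Vx0 sol T0.
have [r VxT] : exists r, V (x T) = r%:E.
  have [I _ hI] := inv 0%N; exists (fine (V (x T))); rewrite fineK //.
  by rewrite fin_numE gt_eqF ?hV.1 //= lt_eqF // (le_lt_trans hI) // ltry.
have [xc _ _ _] := sol.
have -> : (\int[@lebesgue_measure R]_(t in `[0%R, T]) W (x t) =
    \int[@lebesgue_measure R]_(t in `[0%R, T]) limn (fun k => (lip_reg W k (x t))%:E))%E.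
  apply: eq_integral => t _; apply/esym/cvg_lim => //.
  exact: lip_reg_cvg.
have mI : measurable (`[0, T]%classic : set (measurableTypeR R)) by exact: measurable_itv.
have mreg k : measurable_fun (`[0, T]%classic : set (measurableTypeR R))
    (fun t => (lip_reg W k (x t))%:E).
  exact: (@measurable_lsc_curve R n _ x T (@lip_reg_lsc R n W W_ge0 k) xc).
have reg_ge0 k t : (0 <= (lip_reg W k (x t))%:E)%E.
  by rewrite lee_fin; have /andP[] := lip_reg_bounds W_ge0 k (x t).
have reg_nd t : nondecreasing_seq (fun k => (lip_reg W k (x t))%:E).
  by move=> k m km; rewrite lee_fin lip_reg_nondecreasing.
rewrite (monotone_convergence _ mI mreg (fun k t _ => reg_ge0 k t) (fun t _ => reg_nd t)).
rewrite Vx0 VxT -EFinM -leeBrDl // -EFinB.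
apply: lime_le.
  apply: ereal_nondecreasing_is_cvgn => k m km.
  by apply: ge0_le_integral => // t _; exact: reg_nd.
apply: nearW => k; have [I -> hI] := inv k.
move: hI; rewrite VxT !lee_fin mulNr expRN mulrC ler_pdivlMr ?expR_gt0 // => hI.
by rewrite mulrC; lra.
Qed.

End Sufficiency.

(** * The characterization of strong Lyapunov pairs *)

Lemma sup_sup_inf_le (R : realType) (n : nat) (D D' Fx Ax : set 'rV[R]_n) :
  D `<=` D' -> (sup_sup_inf D Fx Ax <= sup_sup_inf D' Fx Ax)%E.
Proof. by move=> DD'; apply: ereal_sup_le => _ [xi /DD' D'xi <-]; exists xi. Qed.

(** Proximal subgradients are Frechet subgradients, so it is enough to derive the
    conditions for the latter and to use them for the former. *)
Theorem theorem5p5 (R : realType) (n : nat)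
    (A F : 'rV[R]_n -> set 'rV[R]_n) (L : R) (V W : 'rV[R]_n -> \bar R) (a : R)
    (subdiff : ('rV[R]_n -> \bar R) -> 'rV[R]_n -> set 'rV[R]_n)
    (hA : maximal_monotone A)
    (hF : lipschitz_cusco L F)
    (hV : proper_fun V) (hVlsc : lower_semicontinuous V)
    (hW : proper_fun W) (hWlsc : lower_semicontinuous W)
    (hVA : edom V `<=` setval_dom A)
    (hW0 : forall x, (0 <= W x)%E)
    (ha : 0 <= a)
    (hsub : subdiff = @prox_subdiff R n \/ subdiff = @frechet_subdiff R n) :
  strong_lyapunov_pair A F V W a <->
  (forall x, edom V x ->
     (sup_sup_inf (subdiff V x) (F x) (A x) <= - (a%:E * V x) - W x)%E /\
     (sup_sup_inf (singular_prox_subdiff V x) (F x) (A x) <= 0)%E).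
Proof.
have prox_frechet x : prox_subdiff V x `<=` frechet_subdiff V x.
  by apply: prox_sub_frechet; exact: hV.1.
have sub_frechet x : subdiff V x `<=` frechet_subdiff V x by case: hsub => ->.
have prox_sub x : prox_subdiff V x `<=` subdiff V x by case: hsub => ->.
split=> [lyap x Vx|decay].
  have [fr sg] := lyapunov_infinitesimal hA hF hV hWlsc hW0 lyap Vx (hVA _ Vx).
  by split => //; exact: le_trans (sup_sup_inf_le _ _ (sub_frechet x)) fr.
apply: (infinitesimal_lyapunov hA.1 hF hV hVlsc hW0 hWlsc ha) => y Vy.
  by apply: le_trans (sup_sup_inf_le _ _ (prox_sub y)) _; have [] := decay y Vy.
by have [] := decay y Vy.
Qed.
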